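(* Let $\mathsf N^k$ be a partial nightrider with $k$ basic moves ($1\le k\le4$). For each $i\ge0$, the coefficient $q!\gamma_i$ of $n^{2q-i}$ in $o_{\mathsf N^k}(q;n)$ is a polynomial in $q$ (whose coefficients are periodic functions of $n$) with leading term $$\Big(-\frac{5k}{24}\Big)^i\frac{q^{2i}}{i!}.$$
   Context: A partial nightrider $\mathsf N^k$ is a rider whose basic moves are any $k$ of the four vectors $(1,2),(2,1),(1,-2),(2,-1)$. On the $n\times n$ board $[n]^2$, two pieces at positions $z,z'$ attack each other if $z'-z$ is an integer multiple of a basic move (including $z=z'$). $u_{\mathsf P}(q;n)$ is the number of placements of $q$ unlabelled pieces on $[n]^2$ with no two attacking, and $o_{\mathsf P}(q;n)=q!\,u_{\mathsf P}(q;n)$ is the labelled count. $u_{\mathsf P}(q;n)$ is a quasipolynomial in $n$ of degree $2q$, written $u_{\mathsf P}(q;n)=\sum_{i=0}^{2q}\gamma_i(n)n^{2q-i}$ with $\gamma_i(n)$ periodic in $n$. *)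

(* Defs.v *)
From HB Require Import structures.
From mathcomp Require Import all_boot all_order all_algebra.
From mathcomp Require Import boolp.
Set Implicit Arguments. Unset Strict Implicit. Unset Printing Implicit Defensive.
Import Order.TTheory GRing.Theory Num.Theory.
Local Open Scope ring_scope.

Definition nr_move (j : 'I_4) : int * int :=
  match val j with
  | 0%N => (1, 2)
  | 1%N => (2, 1)
  | 2%N => (1, -2)
  | _ => (2, -1)
  end.

(* A partial nightrider N^k is given by the set M of its k basic moves.
   Positions on the n x n board are pairs of ordinals (board [n]^2 shifted
   by (1,1), which does not affect attacks). z attacks z' iff z' - z is an
   integer multiple of a basic move (this includes z = z'). *)
Definition attacks (M : {set 'I_4}) (n : nat) (z z' : 'I_n * 'I_n) : Prop :=
  exists2 j, j \in M &
    exists t : int,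
      (z'.1)%:Z - (z.1)%:Z = t * (nr_move j).1 /\
      (z'.2)%:Z - (z.2)%:Z = t * (nr_move j).2.

Definition nonattacking (M : {set 'I_4}) (n : nat) (P : {set 'I_n * 'I_n}) : Prop :=
  forall z z', z \in P -> z' \in P -> z != z' -> ~ attacks M z z'.

Definition u_count (M : {set 'I_4}) (q n : nat) : nat :=
  #|[set P : {set 'I_n * 'I_n} | (#|P| == q) && `[< nonattacking M P >]]|.

(* o_{N^k}(q;n) = q! u_{N^k}(q;n): labelled count. *)
Definition o_count (M : {set 'I_4}) (q n : nat) : nat := (q`! * u_count M q n)%N.

Definition periodic (f : nat -> rat) : Prop :=
  exists p : nat, (0 < p)%N /\ forall n, f (n + p)%N = f n.

(* Main.v *)
Require Import Defs.
From HB Require Import structures.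
From mathcomp Require Import all_boot all_order all_algebra.
From mathcomp Require Import boolp.
From mathcomp Require Import zify ring lra.
Import Order.TTheory GRing.Theory Num.Theory.
Local Open Scope ring_scope.

(** The labelled count o(q;n) is the sum over q-tuples of positions of the
    indicator that the attack graph has no edge.  Binomial inversion gives
    o(q;n) = sum_r C(q,r) (n^2)^(q-r) h_r(n), where h_r sums over r-tuples a
    weight that vanishes as soon as the attack graph of the tuple has an isolated
    vertex.  Hence h_r(n) = O(n^(3r/2)), so only r <= 2i contributes to the
    coefficient of n^(2q-i), which is thus a polynomial in q of degree at most 2i,
    and its leading term comes from the coefficient of n^(3i) in h_(2i).  Pairing
    off one position with its only neighbour gives
    h_(r+2) = -(r+1) E h_r + lower order, with E ~ (5k/12) n^3 the number of
    attacking ordered pairs.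

    Each h_r is quasipolynomial in n because the functions generated by
    polynomials, congruence conditions and signs of homogeneous linear forms are
    stable under summation of one variable over 0 <= y < n; homogeneity makes the
    final sign conditions on n constant for n > 0. *)

Set Implicit Arguments. Unset Strict Implicit. Unset Printing Implicit Defensive.

(** * Summation of piecewise quasipolynomials *)

Fixpoint dot (c : nat -> int) (e : seq int) : int :=
  if e is x :: e' then c 0%N * x + dot (fun i => c i.+1) e' else 0.

(* The arguments are the board size n and a list of integer variables, absent
   variables counting as 0. *)
Definition lin (L : nat -> seq int -> int) : Prop :=
  exists c0 c, forall n e, L n e = c0 * n%:Z + dot c e.

(** Sign conditions carry no constant term, so once every variable is summed out their truth is
    constant for [n > 0]. An offset is harmless in a congruence, where it leaves the period
    unchanged. *)
Inductive pq : (nat -> seq int -> rat) -> Prop :=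
| pq_const a : pq (fun _ _ => a)
| pq_lin L : lin L -> pq (fun n e => (L n e)%:~R)
| pq_ge0 L : lin L -> pq (fun n e => (0 <= L n e)%R%:R)
| pq_dvd (m : nat) (c : int) L : (0 < m)%N -> lin L ->
    pq (fun n e => (m%:Z %| L n e + c)%Z%:R)
| pq_add f g : pq f -> pq g -> pq (fun n e => f n e + g n e)
| pq_mul f g : pq f -> pq g -> pq (fun n e => f n e * g n e)
| pq_ext f g : (forall n e, f n e = g n e) -> pq f -> pq g.

Lemma dotD c d e : dot (fun i => c i + d i) e = dot c e + dot d e.
Proof. by elim: e c d => [|x e IH] c d /=; rewrite ?addr0 // IH; ring. Qed.

Lemma dotZ a c e : dot (fun i => a * c i) e = a * dot c e.
Proof. by elim: e c => [|x e IH] c /=; rewrite ?mulr0 // IH; ring. Qed.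

Lemma linD L L' : lin L -> lin L' -> lin (fun n e => L n e + L' n e).
Proof.
move=> [a [c Hc]] [b [d Hd]]; exists (a + b), (fun i => c i + d i) => n e.
by rewrite Hc Hd dotD; ring.
Qed.

Lemma linZ a L : lin L -> lin (fun n e => a * L n e).
Proof.
move=> [b [c Hc]]; exists (a * b), (fun i => a * c i) => n e.
by rewrite Hc dotZ; ring.
Qed.

Lemma linB L L' : lin L -> lin L' -> lin (fun n e => L n e - L' n e).
Proof.
move=> HL HL'; have [c0 [c E]] := linD HL (linZ (-1) HL').
by exists c0, c => n e; rewrite -E mulN1r.
Qed.

Lemma lin_nth i : lin (fun _ e => nth 0 e i).
Proof.
exists 0, (fun j => (i == j)%:R) => n e; rewrite mul0r add0r.
elim: e i => [|x e IH] [|i] //=.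
- rewrite mul1r; suff -> : dot (fun=> 0) e = 0 by rewrite addr0.
  by elim: e {IH} => //= y e ->; rewrite mul0r.
- by rewrite mul0r add0r IH.
Qed.

Lemma lin_size : lin (fun n _ => n%:Z).
Proof.
exists 1, (fun=> 0) => n e; rewrite mul1r.
suff -> : dot (fun=> 0) e = 0 by rewrite addr0.
by elim: e => //= y e ->; rewrite mul0r.
Qed.

Lemma lin_cons L : lin L ->
  exists L' c, lin L' /\ forall n e y, L n (y :: e) = L' n e + c * y.
Proof.
move=> [c0 [c Hc]].
exists (fun n e => c0 * n%:Z + dot (fun i => c i.+1) e), (c 0%N); split.
  by exists c0, (fun i => c i.+1).
by move=> n e y; rewrite Hc /=; ring.
Qed.

Lemma pq_opp f : pq f -> pq (fun n e => - f n e).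
Proof.
move=> Hf; apply: (@pq_ext (fun n e => -1 * f n e)).
  by move=> n e; rewrite mulN1r.
by apply: pq_mul => //; apply: pq_const.
Qed.

Lemma pq_sub f g : pq f -> pq g -> pq (fun n e => f n e - g n e).
Proof. by move=> Hf Hg; apply: pq_add => //; apply: pq_opp. Qed.

Lemma pq_sum (I : Type) (r : seq I) (f : I -> nat -> seq int -> rat) :
  (forall i, pq (f i)) -> pq (fun n e => \sum_(i <- r) f i n e).
Proof.
move=> Hf; elim: r => [|i r IH].
  by apply: (@pq_ext (fun _ _ => 0)) => [n e|]; [rewrite big_nil | apply: pq_const].
apply: (@pq_ext (fun n e => f i n e + \sum_(i <- r) f i n e)).
  by move=> n e; rewrite big_cons.
exact: pq_add.
Qed.

Lemma pq_prod (I : Type) (r : seq I) (f : I -> nat -> seq int -> rat) :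
  (forall i, pq (f i)) -> pq (fun n e => \prod_(i <- r) f i n e).
Proof.
move=> Hf; elim: r => [|i r IH].
  by apply: (@pq_ext (fun _ _ => 1)) => [n e|]; [rewrite big_nil | apply: pq_const].
apply: (@pq_ext (fun n e => f i n e * \prod_(i <- r) f i n e)).
  by move=> n e; rewrite big_cons.
exact: pq_mul.
Qed.

Lemma pq_horner (P : {poly rat}) f : pq f -> pq (fun n e => P.[f n e]).
Proof.
move=> Hf; elim/poly_ind: P => [|P c IH].
  by apply: (@pq_ext (fun _ _ => 0)) => [n e|]; [rewrite horner0 | apply: pq_const].
apply: (@pq_ext (fun n e => P.[f n e] * f n e + c)) => [n e|].
  by rewrite hornerMXaddC.
by apply: pq_add; [apply: pq_mul | apply: pq_const].
Qed.

Lemma pq_le0 L : lin L -> pq (fun n e => (L n e <= 0)%R%:R).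
Proof.
move=> /(linZ (-1)) /pq_ge0; apply: pq_ext => n e.
by rewrite mulN1r oppr_ge0.
Qed.

Lemma pq_eq0 L : lin L -> pq (fun n e => (L n e == 0)%:R).
Proof.
move=> HL; apply: pq_ext (pq_mul (pq_ge0 HL) (pq_le0 HL)) => n e.
by rewrite -natrM mulnb eq_le andbC.
Qed.

(** The floor is the exact quotient after subtracting the residue, and the residue is the finite sum
    of [r] times the indicator of the class of [r]. *)
Lemma pq_floor (m : nat) (b : int) L : (0 < m)%N -> lin L ->
  pq (fun n e => ((L n e + b) %/ m%:Z)%Z%:~R).
Proof.
move=> m0 HL.
pose g (r : nat) n e : rat := (m%:Z %| L n e + (b - r%:Z))%Z%:R * r%:R.
apply: (@pq_ext (fun n e =>
    ((L n e)%:~R + b%:~R - \sum_(r <- iota 0 m) g r n e) * (m%:R)^-1)); last first.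
  apply: pq_mul; last exact: pq_const.
  apply: pq_sub; first by apply: pq_add; [apply: pq_lin | apply: pq_const].
  by apply: pq_sum => r; apply: pq_mul; [apply: pq_dvd | apply: pq_const].
move=> n e; set x := L n e + b.
have mz : m%:Z != 0 by lia.
have -> : \sum_(r <- iota 0 m) g r n e = (x %% m%:Z)%Z%:~R.
  have x0 := modz_ge0 x mz; have xm := ltz_pmod x (m0 : 0 < m%:Z).
  case E: (x %% m%:Z)%Z x0 xm => [k|//] _ km.
  rewrite (bigD1_seq k) ?iota_uniq ?mem_iota //=.
  rewrite big1_seq ?addr0 => [|r /andP[rk]].
    rewrite /g addrA -/x.
    have -> : (m%:Z %| x - k%:Z)%Z.
      by rewrite -eqz_mod_dvd E modz_small // km; lia.
    by rewrite mul1r.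
  rewrite mem_iota /= => rm; rewrite /g addrA -/x.
  case D: (m%:Z %| x - r%:Z)%Z; last by rewrite mul0r.
  move: D; rewrite -eqz_mod_dvd E modz_small; last by lia.
  by move=> /eqP []; lia.
have -> : (L n e)%:~R + b%:~R = x%:~R :> rat by rewrite -intrD.
rewrite {1}(divz_eq x m%:Z) intrD intrM addrK mulfK //.
by rewrite intr_eq0.
Qed.

(** * Antidifferences of polynomials and of quasipolynomials in one integer *)

Definition ff_poly (k : nat) : {poly rat} :=
  \prod_(i <- iota 0 k) ('X - (i%:R)%:P).

Lemma size_ff_poly k : size (ff_poly k) = k.+1.
Proof. by rewrite size_prod_XsubC size_iota. Qed.

Lemma lead_ff_poly k : (ff_poly k)`_k = 1.
Proof.
have /monicP : ff_poly k \is monic by apply: monic_prod_XsubC.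
by rewrite /lead_coef size_ff_poly.
Qed.

Lemma ff_polyS k : ff_poly k.+1 = ff_poly k * ('X - (k%:R)%:P).
Proof. by rewrite /ff_poly -[k.+1]addn1 iotaD big_cat /= big_seq1 add0n. Qed.

Lemma ff_polyD1 k x : (ff_poly k.+1).[x + 1] = (x + 1) * (ff_poly k).[x].
Proof.
elim: k => [|k IH].
  by rewrite ff_polyS /ff_poly big_nil !hornerE.
rewrite ff_polyS hornerM IH (ff_polyS k) hornerM !hornerXsubC -natr1; ring.
Qed.

Lemma ff_poly_nat k q : (ff_poly k).[q%:R] = (q ^_ k)%:R.
Proof.
elim: k => [|k IH]; first by rewrite /ff_poly big_nil hornerE.
rewrite ff_polyS hornerM IH ffactnSr natrM !hornerE.
have [kq|qk] := leqP k q; first by rewrite natrB.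
by rewrite ffact_small ?mul0r.
Qed.

(** The difference of [ff_poly n.+1] is [n.+1] times [ff_poly n], which is monic of degree [n];
    subtracting a multiple of the latter lowers the size, and induction finishes. *)
Lemma poly_antidifference (q : {poly rat}) :
  exists Q : {poly rat}, forall x, Q.[x + 1] - Q.[x] = q.[x].
Proof.
move: {2}(size q) (leqnn (size q)) => n; elim: n q => [|n IH] q sq.
  exists 0 => x; move: sq; rewrite leqn0 size_poly_eq0 => /eqP ->.
  by rewrite !horner0 subrr.
have [|Q HQ] := IH (q - q`_n *: ff_poly n).
  apply/leq_sizeP => j; rewrite leq_eqVlt coefB coefZ => /orP[/eqP <-|nj].
    by rewrite lead_ff_poly mulr1 subrr.
  rewrite (nth_default _ (leq_trans sq nj)) (_ : (ff_poly n)`_j = 0) ?mulr0 ?subrr //.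
    by rewrite nth_default ?size_ff_poly.
exists (Q + (q`_n / n.+1%:R) *: ff_poly n.+1) => x.
have := HQ x; rewrite hornerD hornerN hornerZ => HQx.
have n0 : (n%:R + 1 : rat) != 0 by rewrite natr1 pnatr_eq0.
have -> : q.[x] = Q.[x + 1] - Q.[x] + q`_n * (ff_poly n).[x] by rewrite HQx; ring.
rewrite !(hornerD, hornerZ) ff_polyD1 ff_polyS hornerM hornerXsubC.
by rewrite -natr1; field.
Qed.

Definition qp (h : int -> rat) : Prop :=
  exists (p : nat) (P : int -> {poly rat}), [/\ (0 < p)%N,
    forall y, P (y + p%:Z) = P y & forall y, h y = (P y).[y%:~R]].

Lemma qp_const a : qp (fun=> a).
Proof. by exists 1%N, (fun=> a%:P); split => // y; rewrite hornerC. Qed.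

Lemma qp_id : qp (fun y => y%:~R).
Proof. by exists 1%N, (fun=> 'X); split => // y; rewrite hornerX. Qed.

Lemma qp_dvd (m : nat) (c : int) : (0 < m)%N ->
  qp (fun y => (m%:Z %| y + c)%Z%:R).
Proof.
move=> m0; exists m, (fun y => ((m%:Z %| y + c)%Z%:R)%:P); split => // y.
  by rewrite addrAC rpredDr ?dvdzz.
by rewrite hornerC.
Qed.

Lemma int_periodM (T : Type) (P : int -> T) (p : int) :
  (forall y, P (y + p) = P y) -> forall (k : int) y, P (y + k * p) = P y.
Proof.
move=> Pp; have Pn (k : nat) y : P (y + k%:Z * p) = P y.
  elim: k y => [|k IH] y; first by rewrite mul0r addr0.
  by rewrite intS mulrDl mul1r addrCA addrC Pp IH.
case=> k y; first exact: Pn.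
by rewrite NegzE mulNr -{2}(subrK (k.+1%:Z * p) y) Pn.
Qed.

Lemma qp_mul f g : qp f -> qp g -> qp (fun y => f y * g y).
Proof.
move=> [p [P [p0 Pp fP]]] [r [Q [r0 Qr gQ]]].
exists (p * r)%N, (fun y => P y * Q y); split.
- by rewrite muln_gt0 p0.
- move=> y; rewrite PoszM (int_periodM Qr).
  by rewrite (mulrC p%:Z) (int_periodM Pp).
- by move=> y; rewrite fP gQ hornerM.
Qed.

Lemma sum_residue (p : nat) (y : int) (F : nat -> rat) : (0 < p)%N ->
  \sum_(c < p) (p%:Z %| y - c%:Z)%Z%:R * F c = F `|(y %% p%:Z)%Z|%N.
Proof.
move=> p0; have pz : p%:Z != 0 by lia.
have r0 := modz_ge0 y pz; have rp := ltz_pmod y (p0 : 0 < p%:Z).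
case E: (y %% p%:Z)%Z r0 rp => [k|//] _ kp.
rewrite (bigD1 (Ordinal (kp : (k < p)%N))) //= big1 ?addr0 => [|c ck].
  by rewrite -eqz_mod_dvd E modz_small ?eqxx ?mul1r //; lia.
case D: (p%:Z %| y - c%:Z)%Z; last by rewrite mul0r.
move: D; rewrite -eqz_mod_dvd E modz_small; last by have := ltn_ord c; lia.
by move=> /eqP [] kc; case/eqP: ck; apply: val_inj.
Qed.

Lemma divz_sub1 (p : nat) (y : int) : (0 < p)%N ->
  ((y - 1) %/ p%:Z)%Z = (y %/ p%:Z)%Z - (p%:Z %| y)%Z%:R.
Proof.
move=> p0; have pz : p%:Z != 0 by lia.
have r0 := modz_ge0 y pz; have rp := ltz_pmod y (p0 : 0 < p%:Z).
have -> : (p%:Z %| y)%Z = ((y %% p%:Z)%Z == 0) by apply/dvdz_mod0P/eqP.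
rewrite {1}(divz_eq y p%:Z).
set q := (y %/ p%:Z)%Z; set r := (y %% p%:Z)%Z in r0 rp *.
have [E|rn0] := eqVneq r 0.
  rewrite E addr0 (_ : q * p%:Z - 1 = (q - 1) * p%:Z + (p%:Z - 1)); last by ring.
  by rewrite divzMDl // divz_small ?addr0 //; lia.
by rewrite -addrA divzMDl // divz_small ?subr0 ?addr0 //; lia.
Qed.

(** Along each residue class [y = p x + c] the function is a polynomial in [x], with antidifference
    [Q c]. The second conclusion keeps the class [pq] closed when a summation limit is a floor. *)
Lemma qp_antidifference h : qp h -> exists H : int -> rat,
  (forall y, H (y + 1) - H y = h y) /\
  (forall (a : nat) (b : int) L, (0 < a)%N -> lin L ->
     pq (fun n e => H ((L n e + b) %/ a%:Z)%Z)).
Proof.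
move=> [p [P [p0 Pp hP]]].
have pz : p%:Z != 0 by lia.
have /choice [Q HQ] : forall c : nat, exists Q : {poly rat}, forall x,
    Q.[x + 1] - Q.[x] = (P c%:Z).[p%:R * x + c%:R].
  move=> c; have [Q HQ] := poly_antidifference (P c%:Z \Po (p%:R *: 'X + (c%:R)%:P)).
  by exists Q => x; rewrite HQ horner_comp !hornerE.
(* By [divz_sub1] the [c]-th floor increases from [y] to [y + 1] exactly when [y] is congruent to
   [c], so a single summand changes. *)
exists (fun y => \sum_(c < p) (Q c).[((y - 1 - c%:Z) %/ p%:Z)%Z%:~R + 1]); split.
  move=> y; rewrite -sumrB hP.
  have -> : P y = P `|(y %% p%:Z)%Z|%N.
    rewrite gez0_abs ?modz_ge0 // {1}(divz_eq y p%:Z) addrC.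
    exact: int_periodM Pp _ _.
  rewrite -(sum_residue y (fun c => (P c%:Z).[y%:~R]) p0).
  apply: eq_bigr => c _.
  rewrite addrK (_ : y - 1 - c%:Z = y - c%:Z - 1); last by ring.
  rewrite divz_sub1 //; case D: (p%:Z %| y - c%:Z)%Z; last first.
    by rewrite subr0 subrr mul0r.
  rewrite mul1r intrB subrK HQ; congr (_.[_]).
  have /(congr1 (fun z : int => z%:~R : rat)) := divzK D.
  rewrite intrM intrB => E; rewrite mulrC -!pmulrn in E *.
  by rewrite E subrK.
move=> a b L a0 HL.
have ap0 : (0 < a * p)%N by rewrite muln_gt0 a0.
(* Nested floors merge: division by [a], a shift by [1 + c] and division by [p] form one division by
   [a * p]. *)
pose T (c : 'I_p) n e := ((L n e + (b - a%:Z * (1 + c%:Z))) %/ (a * p)%N%:Z)%Z.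
apply: (@pq_ext (fun n e => \sum_(c < p) (Q c).[(T c n e)%:~R + 1])).
  move=> n e; apply: eq_bigr => c _; congr (_.[_%:~R + 1]).
  rewrite /T PoszM divzMA_ge0 //; congr (_ %/ _)%Z.
  rewrite (_ : _ + _ = - (1 + c%:Z) * a%:Z + (L n e + b)); last by ring.
  by rewrite divzMDl; [ring | lia].
apply: pq_sum => c; apply: pq_horner; apply: pq_add; last exact: pq_const.
exact: pq_floor.
Qed.

(** * Normal forms in the summation variable *)

Inductive cut : (nat -> seq int -> int -> rat) -> Prop :=
| cut_none : cut (fun _ _ _ => 1)
| cut_le (a : nat) (b : bool) L : (0 < a)%N -> lin L ->
    cut (fun n e y => (a%:Z * y + b%:Z <= L n e)%R%:R).

(** The variable [y] about to be summed is isolated: only parameters in [g], only [y] in [h], and at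
    most one upper bound on [y]. The Boolean of a cut makes the bound strict; lower bounds are
    complements of strict upper bounds. *)
Inductive nf : (nat -> seq int -> int -> rat) -> Prop :=
| nf_term g h t : pq g -> qp h -> cut t -> nf (fun n e y => g n e * h y * t n e y)
| nf_add f g : nf f -> nf g -> nf (fun n e y => f n e y + g n e y)
| nf_ext f g : (forall n e y, f n e y = g n e y) -> nf f -> nf g.

Lemma nf_pq g : pq g -> nf (fun n e _ => g n e).
Proof.
move=> Hg; apply: nf_ext (nf_term Hg (qp_const 1) cut_none) => n e y.
by rewrite !mulr1.
Qed.

Lemma nf_qp h : qp h -> nf (fun _ _ y => h y).
Proof.
move=> Hh; apply: nf_ext (nf_term (pq_const 1) Hh cut_none) => n e y.
by rewrite mulr1 mul1r.
Qed.

Lemma nf_cut t : cut t -> nf t.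
Proof.
move=> Ht; apply: nf_ext (nf_term (pq_const 1) (qp_const 1) Ht) => n e y.
by rewrite !mul1r.
Qed.

Lemma nf_scale g f : pq g -> nf f -> nf (fun n e y => g n e * f n e y).
Proof.
move=> Hg; elim=> {f} [g' h t Hg' Hh Ht|f1 f2 _ IH1 _ IH2|f1 f2 E _ IH].
- apply: nf_ext (nf_term (pq_mul Hg Hg') Hh Ht) => n e y; ring.
- by apply: nf_ext (nf_add IH1 IH2) => n e y; rewrite mulrDr.
- by apply: nf_ext IH => n e y; rewrite E.
Qed.

Lemma nf_qscale h f : qp h -> nf f -> nf (fun n e y => h y * f n e y).
Proof.
move=> Hh; elim=> {f} [g h' t Hg Hh' Ht|f1 f2 _ IH1 _ IH2|f1 f2 E _ IH].
- apply: nf_ext (nf_term Hg (qp_mul Hh Hh') Ht) => n e y; ring.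
- by apply: nf_ext (nf_add IH1 IH2) => n e y; rewrite mulrDr.
- by apply: nf_ext IH => n e y; rewrite E.
Qed.

(* Of two cuts a y + b <= L and a' y + b' <= L' the one with the smaller bound
   L / a implies the other; at a tie the strict one (b = 1) does.  Comparing
   the bounds is a homogeneous linear condition on the parameters. *)
Lemma nf_cut_mul t t' : cut t -> cut t' -> nf (fun n e y => t n e y * t' n e y).
Proof.
have wl (a a' : nat) (b b' : bool) L L' : (0 < a)%N -> (0 < a')%N -> b' ==> b ->
    lin L -> lin L' ->
    nf (fun n e y => (a%:Z * y + b%:Z <= L n e)%R%:R * (a'%:Z * y + b'%:Z <= L' n e)%R%:R).
  move=> a0 a'0 bb HL HL'.
  pose D n e := a%:Z * L' n e + (- a'%:Z) * L n e.
  have HD : lin D by apply: linD; apply: linZ.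
  have C1 := nf_scale (pq_ge0 HD) (nf_cut (cut_le b a0 HL)).
  have C2 := nf_scale (pq_sub (pq_const 1) (pq_ge0 HD)) (nf_cut (cut_le b' a'0 HL')).
  apply: nf_ext (nf_add C1 C2) => n e y /=; rewrite /D {C1 C2 HD D}.
  have [le|lt] := leP 0 (a%:Z * L' n e + - a'%:Z * L n e).
    rewrite mul1r subrr mul0r addr0 -natrM mulnb; congr (_%:R); congr nat_of_bool.
    apply/idP/andP => [H|[]//]; split=> //.
    by case: b b' bb H => [] [] //= _ H; nia.
  rewrite mul0r add0r subr0 mul1r -natrM mulnb; congr (_%:R); congr nat_of_bool.
  apply/idP/andP => [H|[]//]; split=> //.
  by case: b b' bb H => [] [] //= _ H; nia.
case=> [|a b L a0 HL] Ht'.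
  by apply: nf_ext (nf_cut Ht') => n e y; rewrite mul1r.
case: Ht' => [|a' b' L' a'0 HL'].
  by apply: nf_ext (nf_cut (cut_le b a0 HL)) => n e y; rewrite mulr1.
case bb: (b' ==> b); first exact: wl.
have {}bb : b ==> b' by case: b b' bb => [] [].
by apply: nf_ext (wl _ _ _ _ _ _ a'0 a0 bb HL' HL) => n e y; rewrite mulrC.
Qed.

Lemma nf_mul f f' : nf f -> nf f' -> nf (fun n e y => f n e y * f' n e y).
Proof.
move=> Hf Hf'; elim: Hf => {f} [g h t Hg Hh Ht|f1 f2 _ IH1 _ IH2|f1 f2 E _ IH].
- elim: Hf' => {f'} [g' h' t' Hg' Hh' Ht'|f1 f2 _ IH1 _ IH2|f1 f2 E _ IH].
  + apply: nf_ext (nf_scale (pq_mul Hg Hg') (nf_qscale (qp_mul Hh Hh') (nf_cut_mul Ht Ht'))) => n e y.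
    by ring.
  + by apply: nf_ext (nf_add IH1 IH2) => n e y; rewrite mulrDr.
  + by apply: nf_ext IH => n e y; rewrite E.
- by apply: nf_ext (nf_add IH1 IH2) => n e y; rewrite mulrDl.
- by apply: nf_ext IH => n e y; rewrite E.
Qed.

Lemma nf_sum (I : Type) (r : seq I) (f : I -> nat -> seq int -> int -> rat) :
  (forall i, nf (f i)) -> nf (fun n e y => \sum_(i <- r) f i n e y).
Proof.
move=> Hf; elim: r => [|i r IH].
  by apply: nf_ext (nf_pq (pq_const 0)) => n e y; rewrite big_nil.
by apply: nf_ext (nf_add (Hf i) IH) => n e y; rewrite big_cons.
Qed.

Lemma nf_cons F : pq F -> nf (fun n e y => F n (y :: e)).
Proof.
elim=> {F}.
- by move=> a; apply: nf_pq; apply: pq_const.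
- move=> L /lin_cons[L' [c [HL' E]]].
  apply: nf_ext (nf_add (nf_pq (pq_lin HL')) (nf_scale (pq_const c%:~R) (nf_qp qp_id))).
  by move=> n e y; rewrite E intrD intrM.
- move=> L /lin_cons[L' [c [HL' E]]].
  case: c E => [[|c]|c] E.
  + by apply: nf_ext (nf_pq (pq_ge0 HL')) => n e y; rewrite E mul0r addr0.
  + have HN := nf_cut (cut_le true (ltn0Sn c) (linZ (-1) HL')).
    apply: nf_ext (nf_add (nf_pq (pq_const 1)) (nf_scale (pq_const (-1)) HN)) => n e y.
    rewrite E; case: leP => H1; case: leP => H2 //=; rewrite ?mulr1 ?mulr0 ?addr0 ?subrr //; lia.
  + apply: nf_ext (nf_cut (cut_le false (ltn0Sn c) HL')) => n e y.
    rewrite E NegzE; congr (nat_of_bool _)%:R; lia.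
- move=> m d L m0 /lin_cons[L' [c [HL' E]]].
  pose T (r : 'I_m) n e y : rat :=
    (m%:Z %| L' n e + (c * r%:Z + d))%Z%:R * (m%:Z %| y + - r%:Z)%Z%:R.
  apply: (@nf_ext (fun n e y => \sum_(r < m) T r n e y)); last first.
    apply: nf_sum => r; apply: nf_scale; first exact: pq_dvd.
    by apply: nf_qp; apply: qp_dvd.
  move=> n e y; rewrite E.
  have mz : m%:Z != 0 by lia.
  transitivity (\sum_(r < m) (m%:Z %| y - r%:Z)%Z%:R
     * ((m%:Z %| L' n e + (c * r%:Z + d))%Z%:R : rat)).
    by apply: eq_bigr => r _; rewrite mulrC.
  rewrite (sum_residue y (fun r : nat => (m%:Z %| L' n e + (c * r%:Z + d))%Z%:R) m0).
  rewrite gez0_abs ?modz_ge0 //; congr (nat_of_bool _)%:R.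
  rewrite {2}(divz_eq y m%:Z).
  rewrite (_ : _ + _ + d = L' n e + (c * (y %% m%:Z)%Z + d) + c * (y %/ m%:Z)%Z * m%:Z); last by ring.
  by rewrite [RHS]rpredDr //; apply: dvdz_mull; exact: dvdzz.
- by move=> f g _ Hf _ Hg; apply: nf_add.
- by move=> f g _ Hf _ Hg; apply: nf_mul.
- by move=> f g E _; apply: nf_ext => n e y; rewrite E.
Qed.

Lemma sum_antidifference (h H : int -> rat) (m : nat) :
  (forall y, H (y + 1) - H y = h y) -> \sum_(y < m) h y%:Z = H m%:Z - H 0.
Proof.
move=> HH; elim: m => [|m IH]; first by rewrite big_ord0 subrr.
rewrite big_ord_recr /= IH -HH (_ : m.+1%:Z = m%:Z + 1); first ring.
by rewrite -addn1 PoszD.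
Qed.

Lemma sum_cut (h H : int -> rat) (n : nat) (T : int) :
  (forall y, H (y + 1) - H y = h y) -> 0 <= T <= n%:Z ->
  \sum_(y < n) h y%:Z * (y%:Z < T)%R%:R = H T - H 0.
Proof.
move=> HH; case: T => [m|//]; rewrite lez_nat => /andP[_ mn].
rewrite -(sum_antidifference m HH) (big_ord_widen n (fun y => h y%:Z) mn) [RHS]big_mkcond /=.
by apply: eq_bigr => y _; rewrite ltz_nat; case: ifP => _; rewrite ?mulr1 ?mulr0.
Qed.

Lemma nf_sum_ord f : nf f -> pq (fun n e => \sum_(y < n) f n e y%:Z).
Proof.
elim=> {f} [g h t Hg Hh Ht|f1 f2 _ IH1 _ IH2|f1 f2 E _ IH]; last 2 first.
- by apply: pq_ext (pq_add IH1 IH2) => n e; rewrite big_split.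
- by apply: pq_ext IH => n e; apply: eq_bigr => y _; rewrite E.
suff Hp : pq (fun n e => \sum_(y < n) h y%:Z * t n e y%:Z).
  apply: pq_ext (pq_mul Hg Hp) => n e; rewrite big_distrr.
  by apply: eq_bigr => y _; rewrite /= mulrA.
have [H [HH Hpq]] := qp_antidifference Hh.
have Hfull : pq (fun n e => H n%:Z - H 0).
  apply: pq_sub; last exact: pq_const.
  by apply: pq_ext (Hpq 1%N 0 _ isT lin_size) => n e; rewrite addr0 divz1.
case: Ht => [|a b L a0 HL].
  apply: pq_ext Hfull => n e; rewrite -(sum_antidifference n HH).
  by apply: eq_bigr => y _; rewrite mulr1.
(* [T] is the least [y] violating the cut (see [TP]), so the sum stops at [T] clamped to
   [[0, n]]. *)
pose T n e := ((L n e + (a%:Z - b%:Z)) %/ a%:Z)%Z.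
have HT : pq (fun n e => H (T n e) - H 0).
  by apply: pq_sub; [apply: Hpq | apply: pq_const].
have az : a%:Z != 0 by lia.
have TP n e y : (a%:Z * y + b%:Z <= L n e) = (y < T n e).
  rewrite /T -lezD1 lez_divRL //; apply/idP/idP; lia.
have [C0 [HC0 C0P]] : exists C0 : nat -> seq int -> bool,
    pq (fun n e => (C0 n e)%:R) /\ forall n e, C0 n e = (0 < T n e).
  exists (fun n e => b%:Z <= L n e); split; last first.
    by move=> n e; rewrite -TP mulr0 add0r.
  case: b {T HT TP}; last exact: pq_ge0.
  apply: pq_ext (pq_sub (pq_const 1) (pq_le0 HL)) => n e.
  by case: leP => H1; case: leP => H2; rewrite ?subrr ?subr0 //; lia.
(* Clamping must be decided by homogeneous conditions. The sign of [D] compares [L] with [a n]: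
   [D >= 0] forces [T >= n] and [D < 0] forces [T <= n], for either value of [b]. *)
pose D n e := L n e + (- a%:Z) * n%:Z.
have HD : lin D by apply: linD => //; apply: linZ; exact: lin_size.
apply: pq_ext (pq_mul HC0 (pq_add (pq_mul (pq_ge0 HD) Hfull)
  (pq_mul (pq_sub (pq_const 1) (pq_ge0 HD)) HT))) => n e /=.
rewrite C0P; case: ltP => T0; last first.
  rewrite mul0r big1 // => y _; rewrite TP ltNge (le_trans T0) ?mulr0 //.
have DT : 0 <= D n e -> n%:Z <= T n e.
  rewrite /D /T lez_divRL // => H0; case: b {T HT TP C0P T0}; lia.
have DT' : D n e < 0 -> T n e <= n%:Z.
  by rewrite /D leNgt -TP => H0; apply/negP => H1; case: b H1 {T HT TP C0P T0 DT}; lia.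
rewrite mul1r; under eq_bigr do rewrite TP.
case: leP => HDn.
  rewrite mul1r subrr mul0r addr0 -(sum_antidifference n HH).
  apply: eq_bigr => y _; rewrite (lt_le_trans _ (DT HDn)) ?mulr1 //.
  by rewrite ltz_nat.
by rewrite mul0r add0r subr0 mul1r (sum_cut HH) // (ltW T0) DT'.
Qed.

Lemma pq_sum_ord G : pq G -> pq (fun n e => \sum_(y < n) G n (y%:Z :: e)).
Proof. by move=> /nf_cons /nf_sum_ord. Qed.

(** * Quasipolynomials in the board size *)

Lemma nat_periodM (T : Type) (P : nat -> T) (p : nat) :
  (forall n, P (n + p)%N = P n) -> forall k n, P (n + k * p)%N = P n.
Proof.
move=> Pp; elim=> [|k IH] n; first by rewrite mul0n addn0.
by rewrite mulSn addnA IH.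
Qed.

(** Agreement is asked only for [n > 0], where the sign of [c0 * n] is that of [c0]; at [n = 0] the
    condition [0 <= c0 * n] always holds. *)
Definition quasipoly (f : nat -> rat) (P : nat -> {poly rat}) : Prop :=
  (exists2 p, (0 < p)%N & forall n, P (n + p)%N = P n) /\
  forall n, (0 < n)%N -> f n = (P n).[n%:R].

Lemma pq_quasipoly G : pq G -> exists P, quasipoly (fun n => G n [::]) P.
Proof.
elim=> {G}.
- by move=> a; exists (fun=> a%:P); split; [exists 1%N | move=> n _; rewrite hornerC].
- move=> L [c0 [c E]]; exists (fun=> c0%:~R *: 'X); split; first by exists 1%N.
  by move=> n _; rewrite E /= addr0 intrM hornerZ hornerX.
- move=> L [c0 [c E]]; exists (fun=> (0 <= c0)%R%:R%:P); split; first by exists 1%N.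
  by move=> n n0; rewrite E /= addr0 hornerC pmulr_lge0 ?ltz_nat.
- move=> m d L m0 [c0 [c E]].
  exists (fun n => (m%:Z %| c0 * n%:Z + d)%Z%:R%:P); split.
    exists m => // n; rewrite PoszD mulrDr addrAC.
    congr ((nat_of_bool _)%:R%:P); rewrite [LHS]rpredDr //; by apply: dvdz_mull; exact: dvdzz.
  by move=> n _; rewrite E /= addr0 hornerC.
- move=> f g _ [P [[p p0 Pp] EP]] _ [Q [[r r0 Qr] EQ]].
  exists (fun n => P n + Q n); split; last by move=> n n0; rewrite EP // EQ // hornerD.
  exists (p * r)%N => [|n]; first by rewrite muln_gt0 p0.
  by rewrite (nat_periodM Qr) mulnC (nat_periodM Pp).
- move=> f g _ [P [[p p0 Pp] EP]] _ [Q [[r r0 Qr] EQ]].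
  exists (fun n => P n * Q n); split; last by move=> n n0; rewrite EP // EQ // hornerM.
  exists (p * r)%N => [|n]; first by rewrite muln_gt0 p0.
  by rewrite (nat_periodM Qr) mulnC (nat_periodM Pp).
- move=> f g E _ [P [Hp EP]]; exists P; split => // n n0.
  by rewrite -E EP.
Qed.

(** * Expansion over attack graphs *)

Section SeqSums.
Variable V : finType.

Fixpoint tsum (r : nat) (F : seq V -> rat) : rat :=
  if r is r'.+1 then \sum_x tsum r' (fun s => F (x :: s)) else F [::].

Lemma tsumS r F : tsum r.+1 F = \sum_x tsum r (fun s => F (x :: s)).
Proof. by []. Qed.

Lemma eq_tsum r F G : (forall s, size s = r -> F s = G s) -> tsum r F = tsum r G.
Proof.
elim: r F G => [|r IH] F G E /=; first exact: E.
by apply: eq_bigr => x _; apply: IH => s ss; apply: E; rewrite /= ss.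
Qed.

Lemma tsum0 r : tsum r (fun=> 0) = 0.
Proof. by elim: r => //= r ->; rewrite big1. Qed.

Lemma tsumD r F G : tsum r (fun s => F s + G s) = tsum r F + tsum r G.
Proof.
elim: r F G => [|r IH] F G //=.
by rewrite -big_split; apply: eq_bigr => x _; apply: IH.
Qed.

Lemma tsumZ r a F : tsum r (fun s => a * F s) = a * tsum r F.
Proof.
elim: r F => [|r IH] F //=.
by rewrite mulr_sumr; apply: eq_bigr => x _; apply: IH.
Qed.

Lemma ler_tsum r F G : (forall s, size s = r -> F s <= G s) -> tsum r F <= tsum r G.
Proof.
elim: r F G => [|r IH] F G E /=; first exact: E.
by apply: ler_sum => x _; apply: IH => s ss; apply: E; rewrite /= ss.
Qed.

Lemma tsum_ge0 r F : (forall s, 0 <= F s) -> 0 <= tsum r F.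
Proof. by move=> F0; rewrite -(tsum0 r); apply: ler_tsum. Qed.

Lemma ler_norm_tsum r F : `|tsum r F| <= tsum r (fun s => `|F s|).
Proof.
elim: r F => [|r IH] F //=.
by apply: le_trans (ler_norm_sum _ _ _) _; apply: ler_sum => x _; apply: IH.
Qed.

Fixpoint picks (s : seq V) : seq (V * seq V) :=
  if s is x :: s' then (x, s') :: [seq (p.1, x :: p.2) | p <- picks s'] else [::].

Lemma picks_perm s p : p \in picks s -> perm_eq s (p.1 :: p.2).
Proof.
elim: s p => //= x s IH p; rewrite inE => /orP[/eqP -> //=|/mapP[q /IH qs -> /=]].
rewrite (perm_trans (_ : perm_eq _ (x :: q.1 :: q.2))) ?perm_cons //.
by rewrite (perm_catCA [:: x] [:: q.1]).
Qed.

Lemma map_fst_picks s : [seq p.1 | p <- picks s] = s.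
Proof. by elim: s => //= x s IH; rewrite -map_comp /comp /= IH. Qed.

Lemma mem_picks s x : x \in s -> exists t, (x, t) \in picks s.
Proof. by rewrite -{1}(map_fst_picks s) => /mapP[[y t] yt /= ->]; exists t. Qed.

Lemma size_picks s : size (picks s) = size s.
Proof. by rewrite -{2}(map_fst_picks s) size_map. Qed.

(** Each of the [r.+1] positions of the removed entry contributes the same sum; the head position is
    split off and the others go by induction. *)
Lemma tsum_picks r (G : V -> seq V -> rat) :
  tsum r.+1 (fun s => \sum_(p <- picks s) G p.1 p.2) = r.+1%:R * \sum_x tsum r (G x).
Proof.
elim: r G => [|r IH] G.
  by rewrite /= mul1r; apply: eq_bigr => x _; rewrite big_seq1.
rewrite [LHS]tsumS.
transitivity (\sum_x (tsum r.+1 (G x) +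
    tsum r.+1 (fun s => \sum_(p <- picks s) G p.1 (x :: p.2)))).
  apply: eq_bigr => x _; rewrite -tsumD; apply: eq_tsum => s _ /=.
  by rewrite big_cons big_map.
rewrite big_split (eq_bigr _ (fun x _ => IH (fun y t => G y (x :: t)))) /=.
rewrite -mulr_sumr /= exchange_big -(natr1 r.+1) mulrDl mul1r addrC; congr (_ + _).
Qed.

End SeqSums.

(** * Independence and signed weights in a graph *)

Section Graph.
Variables (V : finType) (A : rel V).
Hypotheses (Ar : reflexive A) (As : symmetric A).

Definition avoid (P : pred V) (x : V) : pred V := fun z => P z && ~~ A x z.

Fixpoint indep (P : pred V) (s : seq V) : bool :=
  if s is x :: s' then P x && indep (avoid P x) s' else true.

(* Equals the sum over subsequences T of s of (-1)^(size s - size T) [indep P T]. *)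
Fixpoint wt (P : pred V) (s : seq V) : rat :=
  if s is x :: s' then - wt P s' + (P x)%:R * wt (avoid P x) s' else 1.

Lemma binomial_shift (h : nat -> rat) (N : rat) q :
  \sum_(r < q.+1) 'C(q, r)%:R * N ^+ (q - r) * (h r.+1 + N * h r) =
  \sum_(r < q.+2) 'C(q.+1, r)%:R * N ^+ (q.+1 - r) * h r.
Proof.
rewrite [RHS]big_ord_recl /= bin0 mul1r subn0.
have -> : \sum_(r < q.+1) 'C(q, r)%:R * N ^+ (q - r) * (h r.+1 + N * h r) =
    \sum_(r < q.+1) 'C(q, r)%:R * N ^+ (q - r) * h r.+1 +
    \sum_(r < q.+1) 'C(q, r)%:R * N ^+ (q.+1 - r) * h r.
  rewrite -big_split; apply: eq_bigr => r _ /=.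
  have rq : (r <= q)%N by rewrite -ltnS.
  by rewrite subSn // exprS; ring.
rewrite [X in _ + X]big_ord_recl /= bin0 mul1r subn0 addrCA; congr (_ + _).
have -> : \sum_(i < q) 'C(q, bump 0 i)%:R * N ^+ (q.+1 - bump 0 i) * h (bump 0 i) =
    \sum_(r < q.+1) 'C(q, r.+1)%:R * N ^+ (q - r) * h r.+1.
  by rewrite big_ord_recr /= bin_small // !mul0r addr0; apply: eq_bigr => r _.
rewrite -big_split; apply: eq_bigr => r _ /=.
by rewrite /bump /= add1n subSS binS natrD; ring.
Qed.

(** Binomial inversion by induction on [q]. The recursion of [wt], summed over the first vertex,
    gives [step]; Pascal's rule in the form [binomial_shift] then recombines the binomial
    coefficients. *)
Lemma tsum_indep q P : tsum q (fun s => (indep P s)%:R) =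
  \sum_(r < q.+1) 'C(q, r)%:R * (#|V|%:R) ^+ (q - r) * tsum r (wt P).
Proof.
elim: q P => [|q IH] P; first by rewrite big_ord1 /= bin0 !mul1r.
rewrite -(binomial_shift (fun r => tsum r (wt P))) /=.
have step r : tsum r.+1 (wt P) + #|V|%:R * tsum r (wt P) =
    \sum_x (P x)%:R * tsum r (wt (avoid P x)).
  rewrite -mulr_natl mulr1 -sumr_const mulr_suml -big_split /=.
  apply: eq_bigr => x _; rewrite mul1r -[X in _ + X]mul1r -!tsumZ -tsumD.
  by apply: eq_tsum => s _ /=; ring.
under [RHS]eq_bigr do rewrite step mulr_sumr /=.
rewrite exchange_big /=; apply: eq_bigr => x _.
transitivity ((P x)%:R * tsum q (fun s => (indep (avoid P x) s)%:R)).
  by rewrite -tsumZ; apply: eq_tsum => s _; rewrite -natrM mulnb.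
by rewrite IH mulr_sumr; apply: eq_bigr => r _ /=; ring.
Qed.

Lemma eq_in_wt P Q s : {in s, P =1 Q} -> wt P s = wt Q s.
Proof.
elim: s P Q => //= x s IH P Q E.
rewrite (IH P Q) => [|z zs]; last by rewrite E // inE zs orbT.
rewrite E ?mem_head // (IH (avoid P x) (avoid Q x)) // => z zs.
by rewrite /avoid E // inE zs orbT.
Qed.

Lemma wt_swap P x y s : wt P (x :: y :: s) = wt P (y :: x :: s).
Proof.
have E : wt (avoid (avoid P x) y) s = wt (avoid (avoid P y) x) s.
  by apply: eq_in_wt => z _; rewrite /avoid andbAC.
by rewrite /= E /avoid (As y x); case: (P x) (P y) (A x y) => [] [] []; rewrite /=; ring.
Qed.

Lemma wt_picks P s p : p \in picks s -> wt P s = wt P (p.1 :: p.2).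
Proof.
elim: s P p => //= x s IH P p; rewrite inE => /orP[/eqP -> //=|/mapP[q qs -> /=]].
rewrite (IH P _ qs) (IH (avoid P x) _ qs).
exact: (wt_swap P x q.1 q.2).
Qed.

Lemma ler_norm_wt P s : `|wt P s| <= 2 ^+ size s.
Proof.
elim: s P => [|x s IH] P /=; first by rewrite normr1.
have -> : 2 ^+ (size s).+1 = 2 ^+ size s + 2 ^+ size s :> rat by rewrite exprS; ring.
apply: le_trans (ler_normD _ _) _; rewrite normrN lerD // normrM normr_nat.
by case: (P x); rewrite ?mul1r // mul0r exprn_ge0.
Qed.

(** Adding [x] to a subsequence changes its sign but not its independence, so the terms cancel in
    pairs. *)
Lemma wt_isolated (P : pred V) x s : P x -> ~~ has (A x) s -> wt P (x :: s) = 0.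
Proof.
move=> /= -> /hasPn nA; rewrite mul1r (eq_in_wt (Q := P)) ?addNr // => z zs.
by rewrite /avoid nA // andbT.
Qed.

(** An isolated edge contributes the factor [-1]: the empty set counts [1], each endpoint [-1], and
    both endpoints together are not independent. *)
Lemma wt_edge x u t : A x u -> ~~ has (A x) t -> ~~ has (A u) t ->
  wt predT (x :: u :: t) = - wt predT t.
Proof.
move=> xu /hasPn nx nu.
have := wt_isolated (P := predT) isT nu.
rewrite /= => ->; rewrite oppr0 add0r mul1r /avoid xu /= mul0r addr0; congr (- _).
by apply: eq_in_wt => z zs; rewrite nx.
Qed.

(* Every entry of t has a neighbour among the other entries of y ++ t: it
   always counts itself once. *)
Definition linked (y t : seq V) : bool :=
  all (fun v => (1 < count (A v) (y ++ t))%N) t.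

Lemma linkedP y t : reflect (forall v, v \in t -> (1 < count (A v) (y ++ t))%N) (linked y t).
Proof. exact: allP. Qed.

Lemma count_picks (s : seq V) p (a : pred V) : p \in picks s -> count a s = (a p.1 + count a p.2)%N.
Proof. by move=> /picks_perm /permP ->. Qed.

Lemma mem_of_picks (s : seq V) p z : p \in picks s -> (z \in s) = (z == p.1) || (z \in p.2).
Proof. by move=> /picks_perm /perm_mem ->; rewrite inE. Qed.

Lemma wt_linked s : wt predT s != 0 -> linked [::] s.
Proof.
move=> w0; apply/linkedP => v vs.
have [t vt] := mem_picks vs.
rewrite (count_picks _ vt) /= Ar add1n ltnS -has_count.
by apply: contraNT w0 => nA; rewrite (wt_picks _ vt) wt_isolated.
Qed.

(** The error made by treating [x] as one end of an isolated edge, whose weight would be minus that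
    of the remaining entries. *)
Definition defect (x : V) (s : seq V) : rat :=
  wt predT (x :: s) + \sum_(p <- picks s) (A x p.1)%:R * wt predT p.2.

(** Counts the ways to exhibit a connected triple [x], [p.1], [p'.1] with a linked remainder; such
    configurations have fewer degrees of freedom than matchings. *)
Definition triple (x : V) (s : seq V) : rat :=
  \sum_(p <- picks s) \sum_(p' <- picks p.2)
    ((A x p.1 && (A x p'.1 || A p.1 p'.1))%:R * (linked [:: p'.1; p.1; x] p'.2)%:R).

Lemma ler_sum_mem (T : eqType) (l : seq T) (F : T -> rat) p :
  (forall q, 0 <= F q) -> p \in l -> F p <= \sum_(q <- l) F q.
Proof.
move=> F0; elim: l => //= q l IH; rewrite inE big_cons => /orP[/eqP <-|/IH le].
  by rewrite lerDl sumr_ge0.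
by rewrite (le_trans le) // lerDr.
Qed.

Lemma triple_ge0 x s : 0 <= triple x s.
Proof. by apply: sumr_ge0 => p _; apply: sumr_ge0 => p' _; rewrite mulr_ge0. Qed.

Lemma triple_ge1 x s u t v t' : (u, t) \in picks s -> (v, t') \in picks t ->
  A x u -> A x v || A u v -> linked [:: v; u; x] t' -> 1 <= triple x s.
Proof.
move=> us vt xu xv lk.
have F0 (p p' : V * seq V) : (0 : rat) <= (A x p.1 && (A x p'.1 || A p.1 p'.1))%:R *
  (linked [:: p'.1; p.1; x] p'.2)%:R by rewrite mulr_ge0.
apply: le_trans (ler_sum_mem _ us); last by move=> p; apply: sumr_ge0.
apply: le_trans (ler_sum_mem _ vt); last by move=> p.
by rewrite /= xu xv lk mulr1.
Qed.

(** Three cases. If [x] is isolated, both terms vanish. If a third vertex is attached to [x] or its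
    neighbour [u], any nonzero weight in the defect would produce a counted triple. Otherwise [x]
    and [u] form an isolated edge and [wt_edge] cancels the only surviving summand. *)
Lemma defect_eq0 x s : triple x s < 1 -> defect x s = 0.
Proof.
move=> T1; rewrite /defect.
have [/hasP[u us xu]|nA] := boolP (has (A x) s); last first.
  rewrite wt_isolated // add0r big_seq big1 // => p ps.
  by rewrite (negPf (hasPn nA _ _)) ?mul0r // (mem_of_picks _ ps) eqxx.
have [t ut] := mem_picks us.
have [/hasP[v vt xuv]|nA] := boolP (has (fun v => A x v || A u v) t).
  have [t' vt'] := mem_picks vt.
  have NL : ~~ linked [:: v; u; x] t'.
    by apply: contraTN T1 => lk; rewrite -leNgt; apply: (triple_ge1 ut vt').
  have cnt z : count (A z) ([:: v; u; x] ++ t') = count (A z) (x :: s).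
    by rewrite /= (count_picks _ ut) /= (count_picks _ vt') /=; ring.
  have zs z : z \in t' -> z \in s.
    by move=> zt; rewrite (mem_of_picks _ ut) /= (mem_of_picks _ vt') /= zt !orbT.
  have -> : wt predT (x :: s) = 0.
    apply/eqP; apply: contraNT NL => /wt_linked /linkedP lk.
    by apply/linkedP => z zt; rewrite cnt lk // inE zs ?orbT.
  rewrite add0r big_seq big1 // => p ps.
  have [xp|] := boolP (A x p.1); last by rewrite mul0r.
  rewrite mul1r; apply/eqP; apply: contraNT NL => /wt_linked /linkedP lk.
  apply/linkedP => z zt; rewrite cnt.
  have := zs z zt; rewrite (mem_of_picks _ ps) => /orP[/eqP ->|zp].
    (* The removed entry [p.1] is adjacent to itself and to [x], which gives the required count of
       two. *)
    by rewrite /= (count_picks _ ps) Ar As xp /=.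
  by rewrite /= (count_picks _ ps) addnA (leq_trans (lk z zp)) ?leq_addl.
have nx : ~~ has (A x) t.
  by apply: contra nA => /hasP[v vt xv]; apply/hasP; exists v; rewrite ?xv.
have nu : ~~ has (A u) t.
  by apply: contra nA => /hasP[v vt xv]; apply/hasP; exists v; rewrite ?xv ?orbT.
have -> : wt predT (x :: s) = - wt predT t.
  rewrite -(wt_edge xu nx nu) /= (wt_picks _ ut) (wt_picks (avoid predT x) ut) //.
have : size [seq p <- picks s | A x p.1] = 1%N.
  rewrite size_filter -(count_map fst) map_fst_picks (count_picks _ ut) /= xu.
  by move: nx; rewrite has_count -leqNgt leqn0 => /eqP ->.
have : (u, t) \in [seq p <- picks s | A x p.1] by rewrite mem_filter /= xu.
case E: [seq p <- picks s | A x p.1] => [|p [|//]] //; rewrite inE => /eqP pE _.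
have -> : \sum_(p <- picks s) (A x p.1)%:R * wt predT p.2 =
    \sum_(p <- [seq p <- picks s | A x p.1]) wt predT p.2.
  rewrite big_filter [RHS]big_mkcond; apply: eq_bigr => p' _.
  by case: (A x p'.1); rewrite ?mul1r ?mul0r.
by rewrite E big_seq1 -pE addNr.
Qed.

Lemma ler_norm_defect x s :
  `|defect x s| <= (2 ^+ (size s).+1 * (size s).+1%:R) * triple x s.
Proof.
have [T1|/defect_eq0 ->] := leP 1 (triple x s); last first.
  by rewrite normr0 !mulr_ge0 ?exprn_ge0 ?triple_ge0.
apply: (@le_trans _ _ (2 ^+ (size s).+1 * (size s).+1%:R * 1)); last first.
  by rewrite ler_wpM2l // mulr_ge0 ?exprn_ge0.
rewrite mulr1 -[(size s).+1%:R]natr1 mulrDr mulr1 addrC.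
apply: le_trans (ler_normD _ _) _; rewrite lerD ?(ler_norm_wt _ (x :: s)) //.
apply: le_trans (ler_norm_sum _ _ _) _.
rewrite big_seq; apply: (@le_trans _ _ (\sum_(p <- picks s | p \in picks s) 2 ^+ (size s).+1)).
  apply: ler_sum => p /picks_perm /perm_size /= sp.
  rewrite normrM normr_nat; apply: (@le_trans _ _ (1 * 2 ^+ size p.2)).
    by rewrite ler_pM ?ler_norm_wt // lern1 leq_b1.
  by rewrite mul1r sp; apply: ler_weXn2l => //; apply: leqW (leqnSn _).
by rewrite -big_seq big_const_seq count_predT iter_addr_0 size_picks mulr_natr.
Qed.

Definition edges : rat := \sum_x \sum_u (A x u)%:R.

Lemma tsum_wt_rec r :
  `|tsum r.+2 (wt predT) + r.+1%:R * edges * tsum r (wt predT)| <=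
  2 ^+ r.+2 * r.+2%:R * \sum_x tsum r.+1 (triple x).
Proof.
have -> : tsum r.+2 (wt predT) + r.+1%:R * edges * tsum r (wt predT) =
    \sum_x tsum r.+1 (defect x).
  rewrite /edges -mulrA mulr_suml mulr_sumr tsumS -big_split.
  apply: eq_bigr => x _; rewrite /defect [RHS]tsumD; congr (_ + _).
  rewrite (tsum_picks r (fun u t => (A x u)%:R * wt predT t)) mulr_suml.
  by congr (_ * _); apply: eq_bigr => u _; rewrite tsumZ.
rewrite mulr_sumr; apply: le_trans (ler_norm_sum _ _ _) _; apply: ler_sum => x _.
apply: le_trans (ler_norm_tsum _ _) _; rewrite -tsumZ; apply: ler_tsum => s ss.
by rewrite -ss; apply: ler_norm_defect.
Qed.

Lemma tsum_triple0 x : tsum 1 (triple x) = 0.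
Proof. by rewrite /= big1 // => y _; rewrite /triple /= big_seq1 big_nil. Qed.

Lemma tsum_triple r x : tsum r.+2 (triple x) = (r.+2 * r.+1)%:R *
  \sum_u \sum_v (A x u && (A x v || A u v))%:R * tsum r (fun t => (linked [:: v; u; x] t)%:R).
Proof.
rewrite (tsum_picks r.+1 (fun u t => \sum_(p <- picks t)
  ((A x u && (A x p.1 || A u p.1))%:R * (linked [:: p.1; u; x] p.2)%:R))).
rewrite natrM -mulrA; congr (_ * _); rewrite mulr_sumr; apply: eq_bigr => u _.
rewrite (tsum_picks r (fun v t =>
  (A x u && (A x v || A u v))%:R * (linked [:: v; u; x] t)%:R)).
by congr (_ * _); apply: eq_bigr => v _; rewrite tsumZ.
Qed.

(** The head has a neighbour besides itself. If one lies in [y], the head joins the context;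
    otherwise one lies in [t] and moves there together with the head. Entries moved to the context
    still count as neighbours. *)
Lemma linked_cons y x t : linked y (x :: t) ->
  (has (A x) y && linked (x :: y) t) ||
  has (fun p => A x p.1 && linked [:: p.1, x & y] p.2) (picks t).
Proof.
move=> /linkedP lk.
have lk' : linked (x :: y) t.
  apply/linkedP => v vt; have := lk v; rewrite inE vt orbT => /(_ isT).
  by rewrite !count_cat /=; lia.
rewrite lk' andbT; have := lk x (mem_head _ _).
rewrite count_cat /= Ar has_count => c1.
have [//|] := boolP (0 < count (A x) y)%N; rewrite -leqNgt leqn0 => /eqP c0 /=.
have /hasP[u ut xu] : has (A x) t by rewrite has_count; lia.
have [t' ut'] := mem_picks ut.
apply/hasP; exists (u, t') => //=; rewrite xu /=.
apply/linkedP => v vt; move/linkedP/(_ v): lk'.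
rewrite (mem_of_picks _ ut') /= vt orbT => /(_ isT).
by rewrite /= !count_cat (count_picks _ ut') /=; lia.
Qed.

Lemma tsum_linkedS r y : tsum r.+1 (fun s => (linked y s)%:R) <=
  \sum_x (has (A x) y)%:R * tsum r (fun s => (linked (x :: y) s)%:R) +
  \sum_x tsum r (fun s => \sum_(p <- picks s)
    (A x p.1)%:R * (linked [:: p.1, x & y] p.2)%:R).
Proof.
rewrite tsumS -big_split [leRHS]/=; apply: ler_sum => x _; rewrite -tsumZ -tsumD.
apply: ler_tsum => s _.
have S0 : (0 : rat) <= \sum_(p <- picks s) (A x p.1)%:R * (linked [:: p.1, x & y] p.2)%:R.
  by apply: sumr_ge0 => p _; rewrite mulr_ge0.
have [/linked_cons/orP[/andP[-> ->]|/hasP[p ps /andP[xp lp]]]|_] := boolP (linked y (x :: s)).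
- by rewrite mulr1 lerDl.
- rewrite ler_wpDl ?mulr_ge0 //.
  apply: le_trans (ler_sum_mem (F := fun p => (A x p.1)%:R * (linked [:: p.1, x & y] p.2)%:R) _ ps).
    by rewrite xp lp mulr1.
  by move=> q; rewrite mulr_ge0.
- by rewrite addr_ge0 ?mulr_ge0.
Qed.

End Graph.

(** * Growth bounds for graphs on [n^2] vertices with degrees of order [n] *)

Definition sparse (K : rat) (n : nat) (V : finType) (A : rel V) : Prop :=
  [/\ (0 < n)%N, reflexive A, symmetric A, #|V| = (n ^ 2)%N &
      forall x, \sum_y (A x y)%:R <= K * n%:R :> rat].

Lemma ler_natX_half (n a b : nat) : (0 < n)%N -> (a <= b)%N ->
  (n%:R ^+ a <= n%:R ^+ b :> rat).
Proof. by move=> n0 ab; rewrite ler_weXn2l // ler1n. Qed.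

(* A graph with no isolated vertex has at most r/2 components, so linked
   r-tuples have at most 3r/2 degrees of freedom. *)
Lemma tsum_linked_bound K r m : 0 <= K -> exists2 C, 0 <= C &
  forall n (V : finType) (A : rel V) (y : seq V), sparse K n A -> size y = m ->
  tsum r (fun s => (linked A y s)%:R) <= C * n%:R ^+ (3 * r)./2.
Proof.
move=> K0; elim/ltn_ind: r m => -[|r] IH m.
  by exists 1 => // n V A y _ _; rewrite /= expr0 mulr1.
have [C1 C10 H1] := IH r (ltnSn r) m.+1.
(* Here the head [x] takes a neighbour [u] out of the tuple, with at most [K n] choices. The factor
   [n^2] on the left anticipates the choices of [x], so the two entries together raise the exponent
   by exactly [3]. *)
have [C2 C20 H2] : exists2 C, 0 <= C &
    forall n (V : finType) (A : rel V) (y : seq V) x, sparse K n A -> size y = m ->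
    tsum r (fun s => \sum_(p <- picks s)
      (A x p.1)%:R * (linked A [:: p.1, x & y] p.2)%:R) * n%:R ^+ 2 <=
    C * n%:R ^+ (3 * r.+1)./2.
  case: r IH {H1} => [|r] IH.
    by exists 0 => // n V A y x _ _; rewrite /= big_nil !mul0r.
  have [C C0 H] := IH r (leqW (ltnSn r)) m.+2.
  exists (r.+1%:R * K * C) => [|n V A y x sp sy]; first by rewrite !mulr_ge0.
  have [n0 _ _ _ deg] := sp.
  rewrite (tsum_picks r (fun u t => (A x u)%:R * (linked A [:: u, x & y] t)%:R)).
  set S := \sum_u _; set B := n%:R ^+ (3 * r)./2 : rat.
  have S_le : S <= K * n%:R * (C * B).
    apply: (@le_trans _ _ (\sum_u (A x u)%:R * (C * B))).
      by apply: ler_sum => u _; rewrite tsumZ ler_wpM2l // H //= sy.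
    by rewrite -mulr_suml ler_wpM2r ?mulr_ge0 ?exprn_ge0.
  apply: (@le_trans _ _ (r.+1%:R * (K * n%:R * (C * B)) * n%:R ^+ 2)).
    by rewrite ler_wpM2r ?exprn_ge0 // ler_wpM2l.
  have -> : (3 * r.+2)./2 = ((3 * r)./2 + 3)%N by lia.
  by rewrite exprD le_eqVlt; apply/orP; left; apply/eqP; rewrite /B; ring.
exists (m%:R * K * C1 + C2) => [|n V A y sp sy].
  by rewrite addr_ge0 ?mulr_ge0.
have [n0 Ar As cV deg] := sp.
apply: le_trans (tsum_linkedS Ar r y) _; rewrite mulrDl lerD //.
  apply: (@le_trans _ _ (\sum_x (has (A x) y)%:R * (C1 * n%:R ^+ (3 * r)./2))).
    by apply: ler_sum => x _; rewrite ler_wpM2l // H1 //= sy.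
  rewrite -mulr_suml; apply: (@le_trans _ _ (m%:R * K * n%:R * (C1 * n%:R ^+ (3 * r)./2))).
    rewrite ler_wpM2r ?mulr_ge0 ?exprn_ge0 //.
    apply: (@le_trans _ _ (\sum_x \sum_(u <- y) (A x u)%:R)).
      apply: ler_sum => x _; case: hasP => [[u uy xu]|_]; last by rewrite sumr_ge0.
      apply: le_trans (ler_sum_mem (F := fun u => (A x u)%:R) _ uy) => //.
      by rewrite xu.
    rewrite exchange_big /=; apply: (@le_trans _ _ (\sum_(u <- y) K * n%:R)).
      by apply: ler_sum => u _; under eq_bigr do rewrite As; apply: deg.
    by rewrite big_const_seq count_predT iter_addr_0 sy -mulrA mulr_natl.
  apply: (@le_trans _ _ (m%:R * K * C1 * n%:R ^+ ((3 * r)./2).+1)).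
    by rewrite exprS le_eqVlt; apply/orP; left; apply/eqP; ring.
  rewrite ler_wpM2l ?mulr_ge0 // ler_natX_half //; lia.
have n20 : (0 : rat) < n%:R ^+ 2 by rewrite exprn_gt0 // ltr0n.
apply: (@le_trans _ _ (\sum_(x : V) (C2 * n%:R ^+ (3 * r.+1)./2) / n%:R ^+ 2)).
  by apply: ler_sum => x _; rewrite ler_pdivlMr // H2.
by rewrite sumr_const cV -[_ *+ (n ^ 2)]mulr_natr natrX divfK // gt_eqF.
Qed.

Lemma tsum_wt_bound K r : 0 <= K -> exists C,
  forall n (V : finType) (A : rel V), sparse K n A ->
  `|tsum r (wt A predT)| <= C * n%:R ^+ (3 * r)./2.
Proof.
move=> K0; have [C C0 H] := tsum_linked_bound r 0 K0.
exists (2 ^+ r * C) => n V A sp; have [n0 Ar As _ _] := sp.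
rewrite -mulrA; apply: le_trans (ler_wpM2l _ (H n V A [::] sp erefl)); last first.
  by rewrite exprn_ge0.
apply: le_trans (ler_norm_tsum _ _) _; rewrite -tsumZ; apply: ler_tsum => s ss.
have [->|/(wt_linked Ar As) ->] := eqVneq (wt A predT s) 0.
  by rewrite normr0 mulr_ge0 ?exprn_ge0.
by rewrite mulr1 -ss ler_norm_wt.
Qed.

(** A connected triple has at most order [n^4] choices and the other [r'] entries at most order
    [n^((3r')/2)]; the factor [n] on the left supplies the fifth power. For [r = 0] two entries form
    no triple and the error is zero. *)
Lemma tsum_wt_rec_bound K r : 0 <= K -> exists C,
  forall n (V : finType) (A : rel V), sparse K n A ->
  `|tsum r.+2 (wt A predT) + r.+1%:R * edges A * tsum r (wt A predT)| * n%:R <=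
  C * (if r is r'.+1 then n%:R ^+ ((3 * r')./2 + 5) else 0).
Proof.
move=> K0; case: r => [|r].
  exists 0 => n V A [n0 Ar As _ _]; rewrite mulr0.
  rewrite pmulr_lle0 ?ltr0n //; apply: le_trans (tsum_wt_rec Ar As 0) _.
  by rewrite big1 ?mulr0 // => x _; apply: tsum_triple0.
have [C C0 H] := tsum_linked_bound r 3 K0.
exists (2 ^+ r.+3 * r.+3%:R * ((r.+2 * r.+1)%:R * (2 * K ^+ 2 * C))) => n V A sp.
have [n0 Ar As cV deg] := sp.
apply: le_trans (ler_wpM2r _ (tsum_wt_rec Ar As r.+1)) _ => //.
have c0 : (0 : rat) <= 2 ^+ r.+3 * r.+3%:R by apply: mulr_ge0 => //; apply: exprn_ge0.
rewrite -[leLHS]mulrA -[leRHS]mulrA ler_wpM2l //.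
under eq_bigr do rewrite tsum_triple.
rewrite -mulr_sumr -[leLHS]mulrA -[leRHS]mulrA ler_wpM2l // exprD.
set B := n%:R ^+ (3 * r)./2.
have B0 : 0 <= B by apply: exprn_ge0.
apply: (@le_trans _ _ ((\sum_(x : V) (2 * (K * n%:R) ^+ 2 * (C * B))) * n%:R)); last first.
  rewrite sumr_const cV -[_ *+ (n ^ 2)]mulr_natr natrX le_eqVlt; apply/orP; left; apply/eqP; ring.
rewrite ler_wpM2r //; apply: ler_sum => x _.
apply: (@le_trans _ _ (\sum_u \sum_v ((A x u)%:R * (A x v)%:R + (A x u)%:R * (A u v)%:R) * (C * B))).
  apply: ler_sum => u _; apply: ler_sum => v _; apply: ler_pM => //.
  - by apply: tsum_ge0.
  - by case: (A x u) (A x v) (A u v) => [] [] [].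
  - exact: H.
under eq_bigr do rewrite -mulr_suml big_split -!mulr_sumr /=.
rewrite -mulr_suml ler_wpM2r ?mulr_ge0 //.
apply: (@le_trans _ _ (\sum_u (A x u)%:R * (2 * (K * n%:R)))).
  by apply: ler_sum => u _; rewrite -mulrDr ler_wpM2l // mulrDl mul1r lerD.
rewrite -mulr_suml (le_trans (ler_wpM2r _ (deg x))) ?mulr_ge0 //.
by rewrite le_eqVlt; apply/orP; left; apply/eqP; ring.
Qed.

(** * Attack graphs of partial nightriders *)

Definition on_line (j : 'I_4) (z z' : int * int) : bool :=
  (nr_move j).2 * (z'.1 - z.1) == (nr_move j).1 * (z'.2 - z.2).

Definition pos (n : nat) (z : 'I_n * 'I_n) : int * int := ((z.1 : nat)%:Z, (z.2 : nat)%:Z).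

Definition adj (M : {set 'I_4}) (n : nat) : rel ('I_n * 'I_n) :=
  fun z z' => [exists j in M, on_line j (pos z) (pos z')].

Lemma ord4P (j : 'I_4) : [\/ j = 0, j = 1, j = 2%:R | j = 3%:R].
Proof.
by case: j => [] [|[|[|[|//]]]] lt; [constructor 1|constructor 2|constructor 3|constructor 4];
  apply: val_inj.
Qed.

(* Each basic move is primitive and has a coordinate equal to 1 or -1, so its
   integer multiples are exactly the lattice points of the line it spans. *)
Lemma on_lineP j (z z' : int * int) :
  on_line j z z' <-> exists t, z'.1 - z.1 = t * (nr_move j).1 /\ z'.2 - z.2 = t * (nr_move j).2.
Proof.
rewrite /on_line; case: (ord4P j) => -> /=; split.
- by move=> /eqP E; exists (z'.1 - z.1); lia.
- by move=> [t []]; lia.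
- by move=> /eqP E; exists (z'.2 - z.2); lia.
- by move=> [t []]; lia.
- by move=> /eqP E; exists (z'.1 - z.1); lia.
- by move=> [t []]; lia.
- by move=> /eqP E; exists (- (z'.2 - z.2)); lia.
- by move=> [t []]; lia.
Qed.

Lemma attacks_adj (M : {set 'I_4}) n (z z' : 'I_n * 'I_n) : attacks M z z' <-> adj M z z'.
Proof.
split=> [[j jM /(on_lineP j (pos z) (pos z')) l]|/exists_inP[j jM /on_lineP l]].
  by apply/exists_inP; exists j.
by exists j.
Qed.

Lemma adj_refl (M : {set 'I_4}) n : (0 < #|M|)%N -> reflexive (@adj M n).
Proof.
move=> /card_gt0P[j jM] z; apply/exists_inP; exists j => //.
by rewrite /on_line !subrr !mulr0.
Qed.

Lemma on_line_sym j z z' : on_line j z z' = on_line j z' z.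
Proof. by rewrite /on_line -[in RHS]opprB mulrN -[z.2 - _]opprB mulrN eqr_opp. Qed.

Lemma adj_sym (M : {set 'I_4}) n : symmetric (@adj M n).
Proof. by move=> z z'; apply: eq_existsb => j; rewrite on_line_sym. Qed.

(** A square is attacked along at most four lines, and each meets every column in at most one square
    because no move has first coordinate zero. *)
Lemma adj_degree (M : {set 'I_4}) n (x : 'I_n * 'I_n) : \sum_y (adj M x y)%:R <= 4%:R * n%:R :> rat.
Proof.
apply: (@le_trans _ _ (\sum_(y : 'I_n * 'I_n) \sum_(j < 4) (on_line j (pos x) (pos y))%:R)).
  apply: ler_sum => y _; have [/exists_inP[j jM l]|_] := boolP (adj M x y); last by rewrite sumr_ge0.
  by rewrite (bigD1 j) //= l lerDl sumr_ge0.
rewrite exchange_big /= mulr_natl -[X in _ *+ X](card_ord 4) -sumr_const.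
apply: ler_sum => j _.
rewrite -(pair_bigA _ (fun a b => (on_line j (pos x) (pos (a, b)))%:R)) /=.
rewrite -[X in _ <= X%:R](card_ord n) -sumr_const.
apply: ler_sum => a _.
have [b lb|nl] := pickP (fun b : 'I_n => on_line j (pos x) (pos (a, b))).
  rewrite (bigD1 b) //= lb big1 ?addr0 // => c cb; case lc: (on_line _ _ _) => //.
  case/eqP: cb; apply: val_inj; move: lb lc; rewrite /on_line /=.
  by case: (ord4P j) => -> /= /eqP H1 /eqP H2; lia.
by rewrite big1 // => b _; rewrite nl.
Qed.

Lemma adj_sparse (M : {set 'I_4}) n : (0 < #|M|)%N -> (0 < n)%N -> sparse 4%:R n (@adj M n).
Proof.
move=> M0 n0; split=> //; first exact: adj_refl.
- exact: adj_sym.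
- by rewrite card_prod card_ord.
- exact: adj_degree.
Qed.

(** * Weight sums as piecewise quasipolynomials *)

Definition clear (M : {set 'I_4}) (n : nat) (y : seq ('I_n * 'I_n)) : pred ('I_n * 'I_n) :=
  fun z => all (fun u => ~~ adj M u z) y.

Definition coords (n : nat) (y : seq ('I_n * 'I_n)) : seq int :=
  flatten [seq [:: (pos u).1; (pos u).2] | u <- y].

Lemma nth_coords n (y : seq ('I_n * 'I_n)) u i : (i < size y)%N ->
  nth 0 (coords y) (2 * i) = (pos (nth u y i)).1 /\
  nth 0 (coords y) (2 * i).+1 = (pos (nth u y i)).2.
Proof. by elim: y i => //= v y IH [//|i] /IH; rewrite mulnS. Qed.

Lemma sum_pos (n : nat) (F : int -> int -> rat) :
  \sum_(z : 'I_n * 'I_n) F (pos z).1 (pos z).2 = \sum_(b < n) \sum_(a < n) F a%:Z b%:Z.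
Proof.
by rewrite exchange_big -(pair_bigA _ (fun a b : 'I_n => F (a : nat)%:Z (b : nat)%:Z)).
Qed.

Lemma pq_clear (M : {set 'I_4}) m : exists2 G, pq G & forall n (y : seq ('I_n * 'I_n)) z, size y = m ->
  (clear M y z)%:R = G n [:: (pos z).1, (pos z).2 & coords y].
Proof.
pose L (j : 'I_4) (i : nat) (_ : nat) e : int :=
  (nr_move j).2 * (nth 0 e 0 - nth 0 e (2 * i.+1)) -
  (nr_move j).1 * (nth 0 e 1 - nth 0 e (2 * i.+1).+1).
have HL j i : lin (L j i).
  by apply: linB; apply: linZ; apply: linB; apply: lin_nth.
exists (fun n e => \prod_(i <- iota 0 m) \prod_(j <- enum M) (1 - (L j i n e == 0)%:R)).
  apply: pq_prod => i; apply: pq_prod => j.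
  by apply: pq_sub; [apply: pq_const | apply: pq_eq0].
move=> n y z sy.
transitivity (\prod_(u <- y) \prod_(j <- enum M) (1 - (on_line j (pos u) (pos z))%:R) : rat).
  rewrite /clear; elim: y {sy} => [|u y IH]; first by rewrite big_nil.
  rewrite /= -mulnb natrM IH big_cons; congr (_ * _).
  rewrite -[LHS]/((~~ adj M u z)%:R : rat) /adj negb_exists_in.
  case: forall_inP => [nl|/forall_inP].
    rewrite big_seq big1 // => j; rewrite mem_enum => /nl/negPf ->.
    by rewrite subr0.
  rewrite negb_forall_in => /exists_inP[j jM]; rewrite negbK => l.
  by rewrite (big_rem j) ?mem_enum //= l subrr mul0r.
rewrite (big_nth z) /index_iota subn0 sy big_seq [RHS]big_seq.
apply: eq_bigr => i; rewrite mem_iota => /andP[_ im]; rewrite add0n -sy in im.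
apply: eq_bigr => j _; congr (1 - (nat_of_bool _)%:R).
have [E1 E2] := nth_coords z im.
rewrite /L mulnS /= E1 E2 /on_line subr_eq0 //.
Qed.

(** Induction on [r] for contexts of every size: the recursion of [wt] gives [- n^2] times the sum
    with the same context, plus a sum over allowed squares [x] with [x] added to the context. The
    latter is two summations over coordinates. *)
Lemma pq_tsum_wt (M : {set 'I_4}) r m : exists2 G, pq G & forall n (y : seq ('I_n * 'I_n)), size y = m ->
  tsum r (wt (@adj M n) (clear M y)) = G n (coords y).
Proof.
elim: r m => [|r IH] m; first by exists (fun _ _ => 1); first exact: pq_const.
have [G1 pG1 E1] := IH m; have [G2 pG2 E2] := IH m.+1; have [Q pQ EQ] := pq_clear M m.
have pS := pq_sum_ord (pq_sum_ord (pq_mul pQ pG2)).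
have pn : pq (fun n _ => n%:R) by apply: pq_ext (pq_lin lin_size).
exists (fun n e => - (n%:R * n%:R * G1 n e) +
    \sum_(b < n) \sum_(a < n) (Q n [:: a%:Z, b%:Z & e] * G2 n [:: a%:Z, b%:Z & e])).
  by apply: pq_add pS; apply: pq_opp; do 2!apply: pq_mul => //.
move=> n y sy; rewrite tsumS.
transitivity (\sum_(x : 'I_n * 'I_n) (- G1 n (coords y) +
    Q n [:: (pos x).1, (pos x).2 & coords y] * G2 n [:: (pos x).1, (pos x).2 & coords y])).
  apply: eq_bigr => x _; rewrite -(E1 _ _ sy) -(EQ _ _ _ sy).
  rewrite -(E2 _ (x :: y)) /= ?sy // -mulN1r -!tsumZ -tsumD; apply: eq_tsum => s _.
  rewrite mulN1r; congr (_ + _ * _); apply: eq_in_wt => z _.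
  by rewrite /avoid /clear /= andbC.
rewrite big_split; congr (_ + _).
  by rewrite sumr_const card_prod card_ord -[LHS]mulr_natl natrM mulrN.
exact: sum_pos (fun a b => Q n [:: a, b & coords y] * G2 n [:: a, b & coords y]).
Qed.

(** * The number of attacking pairs *)

Lemma sum_ord_lt (n k : nat) (F : nat -> rat) : (k <= n)%N ->
  \sum_(a < n) (a < k)%N%:R * F a = \sum_(a < k) F a.
Proof.
move=> kn; rewrite (big_ord_widen n F kn) [RHS]big_mkcond /=.
by apply: eq_bigr => a _; case: ifP => _; rewrite ?mul1r ?mul0r.
Qed.

Lemma sum_shift_count (n m : nat) :
  \sum_(a < n) \sum_(b < n) ((b : nat) == (a + m)%N)%:R = (n - m)%:R :> rat.
Proof.
transitivity (\sum_(a < n) (a < n - m)%N%:R * 1 : rat); last first.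
  by rewrite (sum_ord_lt (fun=> 1)) ?leq_subr // sumr_const card_ord.
apply: eq_bigr => a _; rewrite mulr1 (_ : (a < n - m) = (a + m < n))%N; last by rewrite ltn_subRL addnC.
have [lt|ge] := ltnP (a + m) n.
  rewrite (bigD1 (Ordinal lt)) // big1 => [|b /andP[_ /eqP bE]].
    by rewrite /= addr0 eqxx.
  by case: eqP => // E; case: bE; apply: val_inj.
rewrite big1 // => b _; case: eqP => // E.
by have := ltn_ord b; rewrite E ltnNge ge.
Qed.

Lemma sum_diff_count (n : nat) (t : int) :
  \sum_(a < n) \sum_(b < n) ((b : nat)%:Z - (a : nat)%:Z == t)%:R = (n - `|t|)%:R :> rat.
Proof.
case: (ltrP t 0) => t0; rewrite -sum_shift_count; last first.
  by apply: eq_bigr => a _; apply: eq_bigr => b _; congr (nat_of_bool _)%:R; lia.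
by rewrite exchange_big; apply: eq_bigr => a _; apply: eq_bigr => b _; congr (nat_of_bool _)%:R; lia.
Qed.

(** A difference [b - a] along the axis where a move has length one forces twice that difference on
    the other axis, leaving [n - 2|b - a|] positions, or none after truncation. A separate [m]
    permits induction on the range. *)
Definition band (n m : nat) : rat :=
  \sum_(a < m) \sum_(b < m) (n - 2 * `|(b : nat)%:Z - (a : nat)%:Z|)%:R.

Lemma on_line_count j n :
  \sum_(x : 'I_n * 'I_n) \sum_(y : 'I_n * 'I_n) (on_line j (pos x) (pos y))%:R = band n n.
Proof.
pose g (a c b d : int) : rat := ((nr_move j).2 * (b - a) == (nr_move j).1 * (d - c))%:R.
transitivity (\sum_(c < n) \sum_(a < n) \sum_(d < n) \sum_(b < n) g a%:Z c%:Z b%:Z d%:Z).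
  rewrite -(@sum_pos n (fun a c => \sum_(d < n) \sum_(b < n) g a c b%:Z d%:Z)).
  by apply: eq_bigr => x _; rewrite -(@sum_pos n (g (pos x).1 (pos x).2)).
have [v1|v2] : (nr_move j).1 = 1 /\ `|(nr_move j).2|%N = 2%N \/
    (nr_move j).1 = 2 /\ `|(nr_move j).2|%N = 1%N.
- by case: (ord4P j) => -> /=; [left|right|left|right].
- have [E1 E2] := v1; rewrite exchange_big; apply: eq_bigr => a _.
  under eq_bigr do rewrite exchange_big.
  rewrite exchange_big; apply: eq_bigr => b _ /=.
  have -> : (n - 2 * `|(b : nat)%:Z - (a : nat)%:Z|)%N =
      (n - `|((nr_move j).2 * ((b : nat)%:Z - (a : nat)%:Z))%R|)%N by rewrite abszM E2.
  rewrite -sum_diff_count; apply: eq_bigr => c _; apply: eq_bigr => d _.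
  by rewrite /g E1 mul1r eq_sym.
- have [E1 E2] := v2; apply: eq_bigr => c _.
  rewrite exchange_big; apply: eq_bigr => d _ /=.
  have -> : (n - 2 * `|(d : nat)%:Z - (c : nat)%:Z|)%N =
      (n - `|((nr_move j).2 * 2 * ((d : nat)%:Z - (c : nat)%:Z))%R|)%N by rewrite !abszM E2.
  rewrite -sum_diff_count; apply: eq_bigr => a _; apply: eq_bigr => b _.
  rewrite /g E1; congr (nat_of_bool _)%:R; move: E2; lia.
Qed.

(** A new row and column of the difference table add the diagonal term [n] and two equal
    off-diagonal sums. *)
Lemma bandS n m :
  band n m.+1 = band n m + n%:R + 2%:R * \sum_(t < m) (n - 2 * t.+1)%:R.
Proof.
have half (F : nat -> rat) : \sum_(a < m) F (m - a)%N = \sum_(t < m) F t.+1.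
  rewrite (reindex_inj rev_ord_inj); apply: eq_bigr => t _ /=; congr F.
  by have := ltn_ord t; lia.
rewrite /band big_ord_recr /=.
under eq_bigr do rewrite big_ord_recr /=.
rewrite big_split /= big_ord_recr /= subrr muln0 subn0.
have E1 : \sum_(a < m) (n - 2 * `|(m%:Z - (a : nat)%:Z)%R|)%:R =
    \sum_(t < m) (n - 2 * t.+1)%:R :> rat.
  rewrite -(half (fun t => (n - 2 * t)%:R)); apply: eq_bigr => a _.
  by congr (_ - 2 * _)%:R; have := ltn_ord a; lia.
have E2 : \sum_(a < m) (n - 2 * `|((a : nat)%:Z - m%:Z)%R|)%:R =
    \sum_(t < m) (n - 2 * t.+1)%:R :> rat.
  by rewrite -E1; apply: eq_bigr => a _; congr (_ - 2 * _)%:R; lia.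
by rewrite E1 E2; ring.
Qed.

Lemma sum_even_small n m : (2 * m <= n)%N ->
  \sum_(t < m) (n - 2 * t.+1)%:R = m%:R * (n%:R - m%:R - 1) :> rat.
Proof.
elim: m => [|m IH] mn; first by rewrite big_ord0 mul0r.
rewrite big_ord_recr /= IH; last by lia.
by rewrite natrB // natrM -[m.+1%:R]natr1; ring.
Qed.

(** Terms with [t >= m] are truncated to zero because [n <= 2 * m.+1]. *)
Lemma sum_even_large n m j : (n <= 2 * m.+1)%N -> (2 * m <= n)%N ->
  \sum_(t < m + j) (n - 2 * t.+1)%:R = m%:R * (n%:R - m%:R - 1) :> rat.
Proof.
move=> nm mn; elim: j => [|j IH]; first by rewrite addn0 sum_even_small.
rewrite addnS big_ord_recr /= IH (_ : (n - _)%N = 0%N) ?addr0 //; lia.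
Qed.

Lemma band_small n m : (2 * m <= n)%N ->
  band n m = n%:R * m%:R ^+ 2 - 2%:R / 3%:R * (m%:R ^+ 3 - m%:R).
Proof.
elim: m => [|m IH] mn; first by rewrite /band big_ord0; ring.
rewrite bandS IH; last by lia.
rewrite sum_even_small; last by lia.
by rewrite -[m.+1%:R]natr1; field.
Qed.

Lemma band_large n m j : (n <= 2 * m.+1)%N -> (2 * m <= n)%N ->
  band n (m + j) = band n m + j%:R * (n%:R + 2%:R * (m%:R * (n%:R - m%:R - 1))).
Proof.
move=> nm mn; elim: j => [|j IH]; first by rewrite addn0; ring.
by rewrite addnS bandS IH sum_even_large // -[j.+1%:R]natr1; ring.
Qed.

(** Truncation sets in at half the range. The first half contributes about [n^3 / 6] by [band_small]
    and the growth beyond it about [n^3 / 4] by [band_large], which gives [5/12]. *)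
Lemma band_bound n : `|band n n - 5%:R / 12%:R * n%:R ^+ 3| <= n%:R.
Proof.
have [m [e [nE e1]]] : exists m e, n = (2 * m + e)%N /\ (e <= 1)%N.
  by exists (n %/ 2)%N, (n %% 2)%N; rewrite mulnC -divn_eq; split=> //; lia.
have -> : band n n = band n (m + (m + e)) by congr band; lia.
rewrite band_large ?band_small; [|lia..].
have m0 : 0 <= m%:R :> rat by [].
have -> : n%:R = 2%:R * m%:R + e%:R :> rat by rewrite nE natrD natrM.
rewrite (natrD _ m e); case: e {nE} e1 => [|[|//]] _; rewrite ler_norml; apply/andP; split; lra.
Qed.

Lemma on_line_unique j j' n (x y : 'I_n * 'I_n) : j != j' ->
  on_line j (pos x) (pos y) -> on_line j' (pos x) (pos y) -> x = y.
Proof.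
case: x y => [a c] [b d] jj H H'.
suff [E1 E2] : (a : nat) = b /\ (c : nat) = d by congr pair; apply: val_inj.
move: jj H H'; rewrite /on_line /=.
by case: (ord4P j) => ->; case: (ord4P j') => -> //= _ /eqP H /eqP H'; lia.
Qed.

(** Distinct moves span lines meeting only at [x], so summing over moves overcounts only the
    diagonal, by [#|M| - 1]. *)
Lemma adj_sum (M : {set 'I_4}) n (x y : 'I_n * 'I_n) : (0 < #|M|)%N ->
  (adj M x y)%:R = \sum_(j in M) (on_line j (pos x) (pos y))%:R
                   - (#|M|%:R - 1) * (x == y)%:R :> rat.
Proof.
move=> M0; have [<-|xy] := eqVneq x y.
  rewrite adj_refl // (eq_bigr (fun=> 1)) => [|j _].
    by rewrite sumr_const mulr1 opprB addrC subrK.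
  by rewrite /on_line !subrr !mulr0.
rewrite mulr0 subr0 /adj; case: exists_inP => [[j jM l]|nl].
  rewrite (bigD1 j) //= l big1 ?addr0 // => i /andP[_ ij].
  case li: (on_line i _ _) => //; case/eqP: xy; exact: on_line_unique ij li l.
rewrite big1 // => j jM; case l: (on_line _ _ _) => //.
by case: nl; exists j.
Qed.

Lemma edges_bound (M : {set 'I_4}) n : (0 < #|M|)%N -> (0 < n)%N ->
  `|edges (@adj M n) - #|M|%:R * (5%:R / 12%:R) * n%:R ^+ 3| <= 2%:R * #|M|%:R * n%:R ^+ 2.
Proof.
move=> M0 n0; set k : rat := #|M|%:R.
have -> : edges (@adj M n) = k * band n n - (k - 1) * n%:R ^+ 2.
  transitivity (\sum_(x : 'I_n * 'I_n) (\sum_(j in M)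
      \sum_(y : 'I_n * 'I_n) (on_line j (pos x) (pos y))%:R - (k - 1))).
    apply: eq_bigr => x _; rewrite exchange_big /=.
    have -> : k - 1 = \sum_(y : 'I_n * 'I_n) (k - 1) * (x == y)%:R.
      rewrite (bigD1 x) //= eqxx mulr1 big1 ?addr0 // => y.
      by rewrite eq_sym => /negPf ->; rewrite mulr0.
    by rewrite -sumrB; apply: eq_bigr => y _; rewrite adj_sum.
  rewrite sumrB exchange_big /=; congr (_ - _).
    under eq_bigr do rewrite on_line_count.
    by rewrite sumr_const mulr_natl.
  by rewrite sumr_const card_prod card_ord -[LHS]mulr_natr natrM.
have -> : k * band n n - (k - 1) * n%:R ^+ 2 - k * (5%:R / 12%:R) * n%:R ^+ 3 =
    k * (band n n - 5%:R / 12%:R * n%:R ^+ 3) - (k - 1) * n%:R ^+ 2 by ring.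
have k1 : 1 <= k by rewrite ler1n.
have n1 : (1 : rat) <= n%:R by rewrite ler1n.
have b := band_bound n.
have nn : n%:R <= n%:R ^+ 2 :> rat by rewrite expr2 ler_peMl.
have n2 : (0 : rat) <= n%:R ^+ 2 by apply: exprn_ge0.
have k0 : 0 <= k by apply: le_trans k1.
have k10 : 0 <= (k - 1) * n%:R ^+ 2 by rewrite mulr_ge0 ?subr_ge0.
apply: le_trans (ler_normB _ _) _; rewrite normrM (ger0_norm k0) (ger0_norm k10).
set z := `|_| in b *; set w := n%:R ^+ 2 in nn n2 *; nra.
Qed.

(** * Labelled and unlabelled placements *)

Lemma tsum_tuple (V : finType) q (F : seq V -> rat) :
  tsum q F = \sum_(t : q.-tuple V) F t.
Proof.
elim: q F => [|q IH] F.
  by rewrite (big_pred1 [tuple]) // => t; rewrite [t]tuple0; apply/esym/eqP.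
rewrite tsumS; under eq_bigr do rewrite IH.
rewrite pair_bigA /= (reindex (fun p : V * q.-tuple V => [tuple of p.1 :: p.2])) //=.
exists (fun t => (thead t, [tuple of behead t])) => [[x t] _|t _] /=.
  by congr pair; apply: val_inj.
by rewrite [RHS]tuple_eta; apply: val_inj.
Qed.

Lemma indepP (V : finType) (A : rel V) P s : reflexive A -> symmetric A -> indep A P s <->
  [/\ all P s, uniq s & {in s &, forall x y, x != y -> ~~ A x y}].
Proof.
move=> Ar As; elim: s P => [|x s IH] P /=; first by split.
split=> [/andP[-> /IH[Ps us ns]]|[/andP[-> Ps] /andP[xs us] ns]].
  have xA y : y \in s -> ~~ A x y by move=> ys; have /andP[] := allP Ps _ ys.
  split.
  - by apply: sub_all Ps => z /andP[].
  - by rewrite us andbT; apply/negP => /xA; rewrite Ar.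
  - move=> y z; rewrite !inE => /orP[/eqP ->|ys] /orP[/eqP ->|zs] yz.
    + by rewrite eqxx in yz.
    + exact: xA.
    + by rewrite As xA.
    + exact: ns.
apply/IH; split=> //; last first.
  by move=> y z ys zs; apply: ns; rewrite inE ?ys ?zs orbT.
apply/allP => y ys; rewrite /avoid (allP Ps) //= ns ?mem_head ?inE ?ys ?orbT //.
by apply: contraNneq xs => ->.
Qed.

(** Independent tuples are grouped by their underlying set; reflexivity forbids repetitions, so each
    set arises from [q!] orderings. *)
Lemma card_indep_sets (V : finType) (A : rel V) q (B : pred {set V}) :
  reflexive A -> symmetric A ->
  (forall P : {set V}, B P <-> (#|P| = q /\ {in P &, forall x y, x != y -> ~~ A x y})) ->
  tsum q (fun s => (indep A predT s)%:R) = (q`! * #|[set P | B P]|)%:R.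
Proof.
move=> Ar As BP; rewrite tsum_tuple -natr_sum -big_mkcond /=; congr (_%:R).
rewrite (partition_big (fun t : q.-tuple V => [set x in t]) B) /=.
  rewrite -sum1dep_card big_distrr /=; apply: eq_bigr => P /BP[cP nP].
  rewrite muln1 -ffactnn -[X in X ^_ _]cP -card_uniq_tuples -sum1dep_card.
  apply: eq_bigl => t; apply/andP/andP => [[/(indepP _ _ Ar As)[_ ut _] /eqP <-]|[tP ut]].
    split=> //; apply/allP => x xt.
    by suff : x \in [set x0 in t] by []; rewrite inE.
  have E : [set x in t] = P.
    apply/eqP; rewrite eqEcard; apply/andP; split.
      by apply/subsetP => z; rewrite inE => /(allP tP).
    by rewrite cP cardsE (card_uniqP ut) size_tuple.
  split; last exact/eqP.
  apply/(indepP _ _ Ar As); split=> //; first by rewrite all_predT.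
  by move=> x y xt yt; apply: nP; rewrite -E inE.
move=> t /(indepP _ _ Ar As)[_ ut nt]; apply/BP; split.
  by rewrite cardsE (card_uniqP ut) size_tuple.
by move=> x y; rewrite !inE => xt yt; apply: nt.
Qed.

(** * Orders of growth and coefficients *)

Definition bigO (d : nat) (f : nat -> rat) : Prop :=
  exists C, forall n, (0 < n)%N -> `|f n| <= C * n%:R ^+ d.

Lemma eq_bigO d f g : (forall n, (0 < n)%N -> f n = g n) -> bigO d f -> bigO d g.
Proof. by move=> E [C H]; exists C => n n0; rewrite -E ?H. Qed.

Lemma bigOD d f g : bigO d f -> bigO d g -> bigO d (fun n => f n + g n).
Proof.
move=> [C H] [C' H']; exists (C + C') => n n0; rewrite mulrDl.
by apply: le_trans (ler_normD _ _) _; rewrite lerD ?H ?H'.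
Qed.

Lemma bigOM d d' f g : bigO d f -> bigO d' g -> bigO (d + d') (fun n => f n * g n).
Proof.
move=> [C H] [C' H']; exists (C * C') => n n0.
rewrite normrM exprD mulrACA; apply: ler_pM => //; [exact: H | exact: H'].
Qed.

Lemma bigOX a d : bigO d (fun n => a * n%:R ^+ d).
Proof. by exists `|a| => n n0; rewrite normrM normrX normr_nat. Qed.

(** Were the degree above [d], the leading term would outgrow the rest. The bound is asked only at
    arbitrarily large [n], as a constituent of a quasipolynomial is controlled on one residue
    class. *)
Lemma poly_bounded_coef (p : {poly rat}) d C :
  (forall m, exists2 n, (m < n)%N & `|p.[n%:R]| <= C * n%:R ^+ d) ->
  forall j, (d < j)%N -> p`_j = 0.
Proof.
move=> H j dj; have [sp|] := leqP (size p) j; first by rewrite nth_default.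
case E: (size p) => [|D] // jD; exfalso.
have dD : (d < D)%N by rewrite (leq_trans dj).
have l0 : lead_coef p != 0 by rewrite lead_coef_eq0 -size_poly_eq0 E.
pose B := `|C| + \sum_(i < D) `|p`_i|.
have B0 : 0 <= B by rewrite addr_ge0 ?sumr_ge0.
have [n mn Hn] := H (Num.bound (B / `|lead_coef p|)).
have nB : B / `|lead_coef p| < n%:R.
  apply: lt_trans (archi_boundP _) _; first by rewrite mulr_ge0 ?invr_ge0.
  by rewrite ltr_nat.
have nn : (0 < n)%N by rewrite (leq_ltn_trans _ mn).
have n0 : (0 : rat) < n%:R by rewrite ltr0n.
move: nB; rewrite ltr_pdivrMr ?normr_gt0 // ltNge => /negP; apply.
have D1 : D = D.-1.+1 by lia.
have := horner_coef p n%:R; rewrite E big_ord_recr /= => pE.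
have pl : p`_D = lead_coef p by rewrite lead_coefE E.
rewrite -(ler_pM2r (exprn_gt0 D.-1 n0)) mulrAC -exprS -D1 mulrC.
have -> : `|lead_coef p| * n%:R ^+ D = `|p.[n%:R] - \sum_(i < D) p`_i * n%:R ^+ i|.
  have -> : p.[n%:R] - \sum_(i < D) p`_i * n%:R ^+ i = lead_coef p * n%:R ^+ D.
    by rewrite pE pl; ring.
  by rewrite normrM normrX normr_nat.
apply: le_trans (ler_normB _ _) _; rewrite mulrDl lerD //.
  apply: le_trans Hn _; apply: (@le_trans _ _ (`|C| * n%:R ^+ d)).
    by rewrite ler_wpM2r ?exprn_ge0 ?ler_norm.
  by rewrite ler_wpM2l // ler_natX_half //; lia.
apply: le_trans (ler_norm_sum _ _ _) _; rewrite mulr_suml; apply: ler_sum => i _.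
rewrite normrM normrX normr_nat ler_wpM2l // ler_natX_half //.
by have := ltn_ord i; lia.
Qed.

Lemma quasipoly_coef0 f P d n j : quasipoly f P -> bigO d f -> (d < j)%N -> (P n)`_j = 0.
Proof.
move=> [[p p0 Pp] fP] [C H]; apply: (poly_bounded_coef (C := C)) => m.
have m0 : (m < n + m.+1 * p)%N by rewrite (leq_trans (leq_pmulr m.+1 p0)) ?leq_addl.
exists (n + m.+1 * p)%N => //; rewrite -(nat_periodM Pp m.+1) -fP ?H //; exact: leq_ltn_trans m0.
Qed.

(** The extra factor [n] says that the remainder has order [d - 1], and still makes sense for
    [d = 0]; it shifts coefficients by one, so [quasipoly_coef0] applies at [d + 1]. *)
Lemma quasipoly_coef f P d c n : quasipoly f P ->
  bigO d (fun n => (f n - c * n%:R ^+ d) * n%:R) -> (P n)`_d = c.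
Proof.
move=> [[p p0 Pp] fP] H; pose Q n := (P n - c *: 'X^d) * 'X.
have HQ : quasipoly (fun n => (f n - c * n%:R ^+ d) * n%:R) Q.
  split; first by exists p => // m; rewrite /Q Pp.
  by move=> m m0; rewrite /Q fP // !hornerE.
have := quasipoly_coef0 n HQ H (ltnSn d).
rewrite /Q coefMX /= coefB coefZ coefXn eqxx mulr1 => /eqP.
by rewrite subr_eq0 => /eqP.
Qed.

(** * Asymptotics of the cluster sums *)

Section Nightrider.
Variable M : {set 'I_4}.
Hypothesis M0 : (0 < #|M|)%N.

(* h_r(n) in the notation of the opening comment. *)
Definition cluster_sum (r n : nat) : rat := tsum r (wt (@adj M n) predT).

Lemma cluster_sum_quasipoly r : exists P, quasipoly (cluster_sum r) P.
Proof.
have [G pG E] := pq_tsum_wt M r 0; have [P [Pp EP]] := pq_quasipoly pG.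
exists P; split=> // n n0; rewrite -EP // -(E n [::] erefl).
by apply: eq_tsum => s _; apply: eq_in_wt.
Qed.

Lemma cluster_sum_bigO r : bigO (3 * r)./2 (cluster_sum r).
Proof.
have [C H] := @tsum_wt_bound 4%:R r isT.
by exists C => n n0; apply: H; apply: adj_sparse.
Qed.

Lemma cluster_sum_rec_bigO r : bigO (3 * r.+1)
  (fun n => (cluster_sum r.*2.+2 n + r.*2.+1%:R * edges (@adj M n) * cluster_sum r.*2 n) * n%:R).
Proof.
have [C H] := @tsum_wt_rec_bound 4%:R r.*2 isT.
exists `|C| => n n0; have := H _ _ _ (adj_sparse M0 n0).
rewrite normrM normr_nat => /le_trans; apply.
case: r {H} => [|r] /=; first by rewrite mulr0; apply: mulr_ge0 => //; apply: exprn_ge0.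
rewrite (_ : ((3 * r.*2.+1)./2 + 5 = 3 * r.+2)%N); last by lia.
by rewrite ler_wpM2r ?exprn_ge0 ?ler_norm.
Qed.

Lemma edges_bigO : bigO 3
  (fun n => (edges (@adj M n) - #|M|%:R * (5%:R / 12%:R) * n%:R ^+ 3) * n%:R).
Proof.
exists (2%:R * #|M|%:R) => n n0; rewrite normrM normr_nat.
apply: le_trans (ler_wpM2r _ (edges_bound M0 n0)) _ => //.
by rewrite -[leLHS]mulrA -exprSr.
Qed.

(** With [k = #|M|], [(2i)! / (2^i i!)] counts the perfect matchings of [2i] entries, and each
    matched pair weighs [- 5k/12]. *)
Definition cluster_sum_lead (i : nat) : rat :=
  (i.*2)`!%:R / i`!%:R * (- ((5 * #|M|)%:R / 24%:R)) ^+ i.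

Lemma cluster_sum_leadS i :
  cluster_sum_lead i.+1 = - (i.*2.+1%:R * (#|M|%:R * (5%:R / 12%:R)) * cluster_sum_lead i).
Proof.
rewrite /cluster_sum_lead doubleS !factS !natrM exprS.
have i1 : i.+1%:R != 0 :> rat by rewrite pnatr_eq0.
have f1 : i`!%:R != 0 :> rat by rewrite pnatr_eq0 -lt0n fact_gt0.
have -> : i.*2.+2%:R = 2%:R * i.+1%:R :> rat by rewrite -natrM; congr (_%:R); lia.
by field; rewrite f1 addrC natr1.
Qed.

(** The error for [i.+1] splits into that of the recursion, that of replacing [edges] by its cubic
    main term, and the error for [i] times the main factor. *)
Lemma cluster_sum_asymp i : bigO (3 * i)
  (fun n => (cluster_sum i.*2 n - cluster_sum_lead i * n%:R ^+ (3 * i)) * n%:R).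
Proof.
elim: i => [|i IH].
  exists 0 => n n0.
  by rewrite /cluster_sum_lead /cluster_sum /= fact0 divr1 !mul1r subrr mul0r normr0 mul0r.
pose beta : rat := #|M|%:R * (5%:R / 12%:R).
have H1 := cluster_sum_rec_bigO i.
have H2 := bigOM (bigOX (- i.*2.+1%:R) 0) (bigOM edges_bigO (cluster_sum_bigO i.*2)).
have H3 := bigOM (bigOX (- (i.*2.+1%:R * beta)) 3) IH.
have E2 : (0 + (3 + (3 * i.*2)./2) = 3 * i.+1)%N by lia.
have E3 : (3 + 3 * i = 3 * i.+1)%N by lia.
rewrite E2 in H2; rewrite E3 in H3.
apply: eq_bigO (bigOD H1 (bigOD H2 H3)) => n n0.
by rewrite cluster_sum_leadS doubleS -E3 exprD /beta; ring.
Qed.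

End Nightrider.

(** * Assembly of the coefficients *)

Lemma periodic_coef f P j : quasipoly f P -> periodic (fun n => (P n)`_j).
Proof. by move=> [[p p0 Pp] _]; exists p; split=> // n; rewrite Pp. Qed.

Lemma periodicZ a f : periodic f -> periodic (fun n => a * f n).
Proof. by move=> [p [p0 Hp]]; exists p; split=> // n; rewrite Hp. Qed.

Lemma periodic_sum (I : Type) (r : seq I) (f : I -> nat -> rat) :
  (forall i, periodic (f i)) -> periodic (fun n => \sum_(i <- r) f i n).
Proof.
move=> Hf; elim: r => [|i r [p [p0 Hp]]].
  by exists 1%N; split=> // n; rewrite !big_nil.
have [s [s0 Hs]] := Hf i; exists (p * s)%N; split=> [|n]; first by rewrite muln_gt0 p0.
by rewrite !big_cons (nat_periodM Hs) mulnC (nat_periodM Hp).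
Qed.

Lemma eq_sum_ord_widen (a b : nat) (F : nat -> rat) : (forall r, (minn a b <= r)%N -> F r = 0) ->
  \sum_(r < a) F r = \sum_(r < b) F r.
Proof.
wlog ab : a b / (a <= b)%N => [H|] F0.
  have [/H|/ltnW/H] := leqP a b; first exact.
  by move=> E; apply/esym/E; rewrite minnC.
rewrite (big_ord_widen b F ab) big_mkcond; apply: eq_bigr => r _ /=.
by case: ltnP => // ar; rewrite F0 // (minn_idPl ab).
Qed.

(** The factor [(x^2)^(q - r)] lifts degree [2r] to [2q], so the distance [i] from the top degree is
    the same for every [r]; the indicator guards the truncated subtraction [2 * r - i]. *)
Lemma sum_coef_rev (p : {poly rat}) (r q : nat) (x : rat) : (r <= q)%N -> (size p <= (2 * r).+1)%N ->
  \sum_(i < (2 * q).+1) (i <= 2 * r)%N%:R * p`_(2 * r - i) * x ^+ (2 * q - i) =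
  (x ^+ 2) ^+ (q - r) * p.[x].
Proof.
move=> rq sp; have rq2 : ((2 * r).+1 <= (2 * q).+1)%N by rewrite ltnS leq_mul2l.
rewrite (horner_coef_wide x sp) mulr_sumr [RHS](reindex_inj rev_ord_inj) /=.
rewrite (big_ord_widen _ (fun i => (x ^+ 2) ^+ (q - r) *
  (p`_((2 * r).+1 - i.+1) * x ^+ ((2 * r).+1 - i.+1))) rq2) [RHS]big_mkcond /=.
apply: eq_bigr => i _; rewrite ltnS; case: leqP => ir; last by rewrite !mul0r.
rewrite mul1r !subSS mulrCA -exprM -exprD; congr (_ * _ ^+ _); lia.
Qed.

Lemma o_count_cluster_sum (M : {set 'I_4}) q n : (0 < #|M|)%N ->
  (q`!)%:R * (u_count M q n)%:R =
  \sum_(r < q.+1) 'C(q, r)%:R * (n%:R ^+ 2) ^+ (q - r) * cluster_sum M r n.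
Proof.
move=> M0; have Ar := @adj_refl M n M0; have As := @adj_sym M n.
rewrite -natrM /u_count.
rewrite -(card_indep_sets (B := fun P => (#|P| == q) && `[< nonattacking M P >]) Ar As).
  rewrite (tsum_indep _ q predT); apply: eq_bigr => r _.
  by rewrite card_prod card_ord natrM -expr2.
move=> P; split=> [/andP[/eqP cP /asboolP nP]|[cP nP]].
  by split=> // x y xP yP xy; apply/negP => /attacks_adj; apply: nP.
apply/andP; split; first exact/eqP.
by apply/asboolP => x y xP yP xy /attacks_adj; apply/negP/nP.
Qed.

Unset Implicit Arguments.

Theorem theorem9p1 (k : nat) (M : {set 'I_4}) :
  (1 <= k <= 4)%N -> #|M| = k ->
  exists gamma : nat -> nat -> nat -> rat,
    (* gamma q i is the periodic coefficient of n^(2q-i) in u(q;n) *)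
    (forall q i, periodic (gamma q i)) /\
    (forall q i n, (2 * q < i)%N -> gamma q i n = 0) /\
    (forall q n, (0 < n)%N ->
       (u_count M q n)%:R =
         \sum_(i < (2 * q).+1) gamma q i n * (n%:R) ^+ (2 * q - i)) /\
    (* q! gamma_i (coefficient of n^(2q-i) in o(q;n)) is a polynomial in q
       with n-periodic coefficients, of degree 2i with leading coefficient
       (-5k/24)^i / i! *)
    (forall i, exists c : nat -> nat -> rat,
       (forall j, periodic (c j)) /\
       (forall j n, (2 * i < j)%N -> c j n = 0) /\
       (forall n, c (2 * i)%N n = (- ((5 * k)%:R / 24%:R)) ^+ i / (i`!)%:R) /\
       (forall q n, (q`!)%:R * gamma q i n =
                    \sum_(j < (2 * i).+1) c j n * (q%:R) ^+ j)).
Proof.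
move=> /andP[k1 _] Mk; have M0 : (0 < #|M|)%N by rewrite Mk.
have /choice [P HP] : forall r, exists P, quasipoly (cluster_sum M r) P.
  by move=> r; apply: cluster_sum_quasipoly.
have P0 r n j : ((3 * r)./2 < j)%N -> (P r n)`_j = 0.
  by apply: quasipoly_coef0 (HP r) _; apply: cluster_sum_bigO.
(* [T i r n] is the share of [cluster_sum M r] in the coefficient of [n^(2q-i)], free of [q]. *)
pose T i r n : rat := (i <= 2 * r)%N%:R * (P r n)`_(2 * r - i).
(* For [r > 2i] the degree [2r - i] exceeds [3r/2]. *)
have T0 i r n : (2 * i < r)%N -> T i r n = 0.
  by move=> ir; rewrite /T P0 ?mulr0 //; lia.
have Tp i r : periodic (T i r) by apply: periodicZ; apply: periodic_coef (HP r).
(* Stopping at [r = 2i], whatever [q] is, makes [q! gamma] a polynomial in [q]. *)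
pose gamma q i n : rat := (q`!%:R)^-1 * \sum_(r < (2 * i).+1) 'C(q, r)%:R * T i r n.
have fact0 q : q`!%:R != 0 :> rat by rewrite pnatr_eq0 -lt0n fact_gt0.
exists gamma; split; [|split; [|split]].
- by move=> q i; apply: periodicZ; apply: periodic_sum => r; apply: periodicZ.
- move=> q i n qi; rewrite /gamma big1 ?mulr0 // => r _.
  rewrite /T; case: leqP => ir; last by rewrite mul0r mulr0.
  by rewrite bin_small ?mul0r //; lia.
- move=> q n n0; apply: (mulfI (fact0 q)); rewrite o_count_cluster_sum // mulr_sumr.
  transitivity (\sum_(i < (2 * q).+1) \sum_(r < q.+1) 'C(q, r)%:R * T i r n * n%:R ^+ (2 * q - i)).
    rewrite exchange_big; apply: eq_bigr => r _ /=.
    have rq : (r <= q)%N by rewrite -ltnS.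
    have sp : (size (P r n) <= (2 * r).+1)%N by apply/leq_sizeP => j jr; apply: P0; lia.
    rewrite (HP r).2 // -mulrA -(sum_coef_rev _ rq sp) mulr_sumr.
    by apply: eq_bigr => i _; rewrite /T !mulrA.
  apply: eq_bigr => i _; rewrite /gamma !mulrA divff // mul1r mulr_suml.
  (* The ranges [r <= q] and [r <= 2i] give the same sum: binomials vanish above [q] and [T]
     vanishes above [2i]. *)
  apply: (eq_sum_ord_widen (F := fun r => 'C(q, r)%:R * T i r n * n%:R ^+ (2 * q - i))) => r.
  rewrite geq_min => /orP[qr|ir]; first by rewrite bin_small // !mul0r.
  by rewrite T0 // mulr0 mul0r.
- move=> i.
  (* The binomial is [ff_poly r] at [q] divided by [r!], and [c j] collects the coefficients of
     [q^j]. *)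
  exists (fun j n => \sum_(r < (2 * i).+1) (ff_poly r)`_j / r`!%:R * T i r n).
  split; [|split; [|split]].
  + by move=> j; apply: periodic_sum => r; apply: periodicZ.
  + move=> j n ij; rewrite big1 // => r _; rewrite nth_default ?mul0r //.
    by rewrite size_ff_poly (leq_trans (ltn_ord r)).
  (* Degree [2i] in [q] is reached only by [r = 2i], where [T] is the coefficient of [n^(3i)]. *)
  + move=> n; rewrite big_ord_recr big1 /= => [|r _]; last first.
      by rewrite nth_default ?mul0r // size_ff_poly.
    rewrite add0r lead_ff_poly /T (_ : (i <= 2 * (2 * i))%N); last by lia.
    have -> : (P (2 * i)%N n)`_(2 * (2 * i) - i) = cluster_sum_lead M i.
      have -> : (2 * (2 * i) - i = 3 * i)%N by lia.
      by apply: quasipoly_coef (HP _) _; rewrite mul2n; apply: cluster_sum_asymp.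
    rewrite /cluster_sum_lead Mk -mul2n !mul1r -!mulrA mulKf ?fact0 //.
    by rewrite mulrC.
  + move=> q n; rewrite /gamma mulrA divff // mul1r.
    under [RHS]eq_bigr do rewrite mulr_suml.
    rewrite exchange_big; apply: eq_bigr => r _ /=.
    have -> : 'C(q, r)%:R = (ff_poly r).[q%:R] / r`!%:R.
      by rewrite ff_poly_nat -bin_ffact natrM mulfK.
    rewrite (@horner_coef_wide _ (2 * i).+1) ?size_ff_poly // !mulr_suml.
    by apply: eq_bigr => j _; ring.
Qed.
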